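(* Let $A$ be a Noetherian semi-local ring such that $A_M$ is a one-dimensional Cohen-Macaulay local ring for every maximal ideal $M$ of $A$. Then $A$ is strictly closed in $\overline{A}$ if and only if $A$ is an Arf ring.
   Context: For a commutative ring $A$, $Q(A)$ denotes its total ring of fractions and $\overline{A}$ the integral closure of $A$ in $Q(A)$. The strict closure of $A$ in $\overline{A}$ is $A^{*}=\{ x \in \overline{A} \mid x \otimes 1 = 1 \otimes x \text{ in } \overline{A} \otimes_A \overline{A}\}$, and $A$ is strictly closed in $\overline{A}$ if $A=A^*$. A Noetherian semi-local ring $A$ such that $A_M$ is a one-dimensional Cohen-Macaulay local ring for every maximal ideal $M$ is called an Arf ring if: (1) every integrally closed ideal $I$ of $A$ containing a non-zerodivisor on $A$ has a principal reduction, i.e., $I^{n+1}=aI^n$ for some $n\ge 0$ and $a\in I$; and (2) if $x,y,z\in A$ are such that $x$ is a non-zerodivisor on $A$ and $y/x, z/x\in Q(A)$ are integral over $A$, then $yz/x\in A$. *)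

(* Defs.v *)
From HB Require Import structures.
From mathcomp Require Import all_boot all_order all_algebra.
From mathcomp Require Import boolp classical_sets cardinality.
From mathcomp Require Import generic_quotient ring_quotient freeg.
From mathcomp Require Import ring.

Set Implicit Arguments.
Unset Strict Implicit.
Unset Printing Implicit Defensive.

Import GRing.Theory.

Local Open Scope ring_scope.
Local Open Scope classical_set_scope.
Local Open Scope quotient_scope.

(* Rings are commutative with 1 != 0. Ideals are classical subsets, and the
   improper ideal is an ideal, contrary to mathcomp's [idealr_closed]. *)

Section Ideals.
Variable A : comNzRingType.
Implicit Types I J M P : set A.

Definition is_ideal I : Prop :=
  [/\ I 0, (forall x y, I x -> I y -> I (x + y))
    & (forall a x, I x -> I (a * x))].

Definition prime_ideal P : Prop :=
  [/\ is_ideal P, ~ P 1 & forall x y, P (x * y) -> P x \/ P y].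

Definition maximal_ideal M : Prop :=
  [/\ is_ideal M, ~ M 1
    & forall J, is_ideal J -> ~ J 1 -> M `<=` J -> J = M].

Definition ideal_gen (G : set A) : set A := smallest is_ideal G.

Definition ideal_mul I J : set A :=
  ideal_gen [set z | exists x y, [/\ I x, J y & z = x * y]].

Fixpoint ideal_pow I (n : nat) : set A :=
  if n is m.+1 then ideal_mul I (ideal_pow I m) else setT.

Definition noetherian : Prop :=
  forall I, is_ideal I -> exists s : seq A, I = ideal_gen [set` s].

Definition semi_local : Prop := finite_set [set M : set A | maximal_ideal M].

(* x is integral over I when x^n + c_1 x^(n-1) + ... + c_n = 0 with c_i in I^i
   for some n; the case n = 0 is impossible since 1 != 0 in A. *)
Definition ideal_integral_closure I : set A :=
  [set x | exists (n : nat) (c : nat -> A),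
     (forall i, (1 <= i <= n)%N -> ideal_pow I i (c i)) /\
     x ^+ n + \sum_(1 <= i < n.+1) c i * x ^+ (n - i) = 0].

Definition integrally_closed_ideal I : Prop :=
  is_ideal I /\ ideal_integral_closure I = I.

Definition has_principal_reduction I : Prop :=
  exists (a : A) (n : nat),
    I a /\ ideal_pow I n.+1 = [set a * y | y in ideal_pow I n].

Lemma maximal_prime M : maximal_ideal M -> prime_ideal M.
Proof.
move=> [Mid M1 Mmax]; split=> // x y Mxy.
have [M0 MD MM] := Mid.
apply: contrapT => /not_orP[nMx nMy].
pose J : set A := [set z | exists m a, M m /\ z = m + a * x].
have Jid : is_ideal J.
  split; first by exists 0, 0; split=> //; rewrite mul0r addr0.
  - move=> _ _ [m [a [Mm ->]]] [m' [a' [Mm' ->]]].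
    by exists (m + m'), (a + a'); split; [exact: MD | ring].
  - move=> b _ [m [a [Mm ->]]].
    by exists (b * m), (b * a); split; [exact: MM | ring].
have MJ : M `<=` J by move=> m Mm; exists m, 0; rewrite mul0r addr0.
have Jx : J x by exists 0, 1; rewrite mul1r add0r.
have [[m [a [Mm e1]]]|nJ1] := pselect (J 1); last first.
  by apply: nMx; rewrite -(Mmax J).
apply: nMy; have -> : y = y * m + a * (x * y).
  by rewrite -{1}[y]mulr1 e1; ring.
by apply: MD; apply: MM.
Qed.

End Ideals.

(* Multiplicative subsets not containing 0, so that localizations are again
   nonzero rings. *)
Record multset (A : comNzRingType) := MultSet {
  multset_set :> A -> Prop;
  multset1 : multset_set 1;
  multsetM : forall s t, multset_set s -> multset_set t -> multset_set (s * t);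
  multset0 : ~ multset_set 0
}.

Section Localization.
Variables (A : comNzRingType) (S : multset A).

Definition denom := {s : A | `[< S s >]}.

Implicit Types p q : A * denom.

Lemma denomP (s : denom) : S (sval s).
Proof. exact: asboolW (valP s). Qed.

Definition to_denom (s : A) (Ss : S s) : denom := exist _ s (asboolT Ss).

Definition denom1 : denom := to_denom (multset1 S).
Definition denomM (s t : denom) : denom :=
  to_denom (multsetM (denomP s) (denomP t)).

Definition loc_eq p q : bool :=
  `[< exists2 u, S u & u * (p.1 * sval q.2 - q.1 * sval p.2) = 0 >].

Lemma loc_eq_refl : reflexive loc_eq.
Proof.
by move=> p; apply/asboolP; exists 1; [exact: multset1|rewrite subrr mulr0].
Qed.

Lemma loc_eq_sym : symmetric loc_eq.
Proof.
move=> p q; apply/asboolP/asboolP => -[u Su e]; exists u => //;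
by rewrite -[LHS]opprK -mulrN opprB e oppr0.
Qed.

Lemma loc_eq_trans : transitive loc_eq.
Proof.
move=> q p r /asboolP[u Su eu] /asboolP[v Sv ev]; apply/asboolP.
exists (u * v * sval q.2).
  by apply: multsetM (denomP _); apply: multsetM.
have -> : u * v * sval q.2 * (p.1 * sval r.2 - r.1 * sval p.2)
  = v * sval r.2 * (u * (p.1 * sval q.2 - q.1 * sval p.2))
    + u * sval p.2 * (v * (q.1 * sval r.2 - r.1 * sval q.2)) by ring.
by rewrite eu ev !mulr0 addr0.
Qed.

Canonical loc_equiv := EquivRel loc_eq loc_eq_refl loc_eq_sym loc_eq_trans.
Canonical loc_encModRel := defaultEncModRel loc_eq.

Definition loc := {eq_quot loc_eq}.

HB.instance Definition _ : EqQuotient _ loc_eq loc := EqQuotient.on loc.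
HB.instance Definition _ := Choice.on loc.

Definition loc_frac (x s : A) (Ss : S s) : loc := \pi_loc (x, to_denom Ss).

Lemma loc_piP p q : reflect (\pi_loc p = \pi_loc q) (loc_eq p q).
Proof. by rewrite -[loc_eq p q]/(loc_equiv p q) -eqmodE; exact: eqP. Qed.

Lemma loc_repr p : loc_eq (repr (\pi_loc p)) p.
Proof. by apply/loc_piP; rewrite reprK. Qed.

Definition loc_zero : loc := \pi_loc (0, denom1).
Definition loc_one : loc := \pi_loc (1, denom1).
Definition loc_opp_pair p := (- p.1, p.2).
Definition loc_add_pair p q :=
  (p.1 * sval q.2 + q.1 * sval p.2, denomM p.2 q.2).
Definition loc_mul_pair p q := (p.1 * q.1, denomM p.2 q.2).

Definition loc_opp := lift_op1 loc loc_opp_pair.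
Definition loc_add := lift_op2 loc loc_add_pair.
Definition loc_mul := lift_op2 loc loc_mul_pair.

Lemma loc_oppE p : loc_opp (\pi_loc p) = \pi_loc (loc_opp_pair p).
Proof.
unlock loc_opp; apply/loc_piP; have /asboolP[u Su e] := loc_repr p.
apply/asboolP; exists u => //=.
by rewrite !mulNr -opprD mulrN e oppr0.
Qed.

Lemma loc_addE p q :
  loc_add (\pi_loc p) (\pi_loc q) = \pi_loc (loc_add_pair p q).
Proof.
unlock loc_add; apply/loc_piP.
have /asboolP[u Su eu] := loc_repr p; have /asboolP[v Sv ev] := loc_repr q.
move: (repr (\pi_loc p)) (repr (\pi_loc q)) eu ev => p' q' eu ev.
apply/asboolP; exists (u * v); first exact: multsetM.
rewrite /=.
have -> : u * v * ((p'.1 * sval q'.2 + q'.1 * sval p'.2) * (sval p.2 * sval q.2)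
   - (p.1 * sval q.2 + q.1 * sval p.2) * (sval p'.2 * sval q'.2))
  = v * sval q.2 * sval q'.2 * (u * (p'.1 * sval p.2 - p.1 * sval p'.2))
    + u * sval p.2 * sval p'.2 * (v * (q'.1 * sval q.2 - q.1 * sval q'.2)) by ring.
by rewrite eu ev !mulr0 addr0.
Qed.

Lemma loc_mulE p q :
  loc_mul (\pi_loc p) (\pi_loc q) = \pi_loc (loc_mul_pair p q).
Proof.
unlock loc_mul; apply/loc_piP.
have /asboolP[u Su eu] := loc_repr p; have /asboolP[v Sv ev] := loc_repr q.
move: (repr (\pi_loc p)) (repr (\pi_loc q)) eu ev => p' q' eu ev.
apply/asboolP; exists (u * v); first exact: multsetM.
rewrite /=.
have -> : u * v * (p'.1 * q'.1 * (sval p.2 * sval q.2)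
   - p.1 * q.1 * (sval p'.2 * sval q'.2))
  = v * q'.1 * sval q.2 * (u * (p'.1 * sval p.2 - p.1 * sval p'.2))
    + u * p.1 * sval p'.2 * (v * (q'.1 * sval q.2 - q.1 * sval q'.2)) by ring.
by rewrite eu ev !mulr0 addr0.
Qed.

Lemma loc_pi_eq p q : p.1 * sval q.2 = q.1 * sval p.2 -> \pi_loc p = \pi_loc q.
Proof.
move=> e; apply/loc_piP/asboolP; exists 1; first exact: multset1.
by rewrite e subrr mulr0.
Qed.

Lemma loc_addA : associative loc_add.
Proof.
elim/quotW=> x; elim/quotW=> y; elim/quotW=> z; rewrite !loc_addE.
by apply: loc_pi_eq => /=; ring.
Qed.

Lemma loc_addC : commutative loc_add.
Proof.
elim/quotW=> x; elim/quotW=> y; rewrite !loc_addE.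
by apply: loc_pi_eq => /=; ring.
Qed.

Lemma loc_add0 : left_id loc_zero loc_add.
Proof.
elim/quotW=> x; rewrite !loc_addE.
by apply: loc_pi_eq => /=; ring.
Qed.

Lemma loc_addN : left_inverse loc_zero loc_opp loc_add.
Proof.
elim/quotW=> x; rewrite loc_oppE !loc_addE.
by apply: loc_pi_eq => /=; ring.
Qed.

HB.instance Definition _ :=
  GRing.isZmodule.Build loc loc_addA loc_addC loc_add0 loc_addN.

Lemma loc_mulA : associative loc_mul.
Proof.
elim/quotW=> x; elim/quotW=> y; elim/quotW=> z; rewrite !loc_mulE.
by apply: loc_pi_eq => /=; ring.
Qed.

Lemma loc_mulC : commutative loc_mul.
Proof.
elim/quotW=> x; elim/quotW=> y; rewrite !loc_mulE.
by apply: loc_pi_eq => /=; ring.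
Qed.

Lemma loc_mul1 : left_id loc_one loc_mul.
Proof.
elim/quotW=> x; rewrite !loc_mulE.
by apply: loc_pi_eq => /=; ring.
Qed.

Lemma loc_mulDl : left_distributive loc_mul +%R.
Proof.
elim/quotW=> x; elim/quotW=> y; elim/quotW=> z.
rewrite -[_ + _]/(loc_add _ _) -[RHS]/(loc_add _ _) !(loc_addE, loc_mulE).
by apply: loc_pi_eq => /=; ring.
Qed.

Lemma loc_one_neq0 : loc_one != 0.
Proof.
apply/eqP => /loc_piP/asboolP[u Su /=].
by rewrite mul0r subr0 !mulr1 => u0; apply: (@multset0 _ S); rewrite -u0.
Qed.

HB.instance Definition _ := GRing.Zmodule_isComNzRing.Build loc
  loc_mulA loc_mulC loc_mul1 loc_mulDl loc_one_neq0.

Definition loc_scale (a : A) (x : loc) : loc := loc_frac a (multset1 S) * x.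

Lemma frac1D (a b : A) : loc_frac (a + b) (multset1 S)
  = loc_frac a (multset1 S) + loc_frac b (multset1 S).
Proof.
rewrite -[RHS]/(loc_add _ _) loc_addE.
by apply: loc_pi_eq => /=; ring.
Qed.

Lemma frac1M (a b : A) : loc_frac (a * b) (multset1 S)
  = loc_frac a (multset1 S) * loc_frac b (multset1 S).
Proof.
rewrite -[RHS]/(loc_mul _ _) loc_mulE.
by apply: loc_pi_eq => /=; ring.
Qed.

Lemma loc_scaleA a b x : loc_scale a (loc_scale b x) = loc_scale (a * b) x.
Proof. by rewrite /loc_scale frac1M mulrA. Qed.

Lemma loc_scale1 : left_id 1 loc_scale.
Proof. by move=> x; rewrite /loc_scale -[loc_frac _ _]/(1 : loc) mul1r. Qed.

Lemma loc_scaleDr : right_distributive loc_scale +%R.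
Proof. by move=> a x y; rewrite /loc_scale mulrDr. Qed.

Lemma loc_scaleDl x : {morph loc_scale^~ x : a b / a + b}.
Proof. by move=> a b; rewrite /loc_scale frac1D mulrDl. Qed.

HB.instance Definition _ := GRing.Zmodule_isLmodule.Build A loc
  loc_scaleA loc_scale1 loc_scaleDr loc_scaleDl.

Lemma loc_scaleAl (a : A) (x y : loc) : a *: (x * y) = a *: x * y.
Proof. exact: mulrA. Qed.

HB.instance Definition _ := GRing.Lmodule_isLalgebra.Build A loc loc_scaleAl.
HB.instance Definition _ := GRing.Lalgebra_isComAlgebra.Build A loc.

End Localization.

Section Multsets.
Variable A : comNzRingType.

Lemma prime_complM (P : set A) : prime_ideal P ->
  forall s t, (~` P) s -> (~` P) t -> (~` P) (s * t).
Proof. by move=> [_ _ PM] s t nPs nPt /PM[]. Qed.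

Lemma prime_compl1 (P : set A) : prime_ideal P -> (~` P) 1.
Proof. by case. Qed.

Lemma prime_compl0 (P : set A) : prime_ideal P -> ~ (~` P) 0.
Proof. by move=> [[P0 _ _] _ _] nP0; apply: nP0. Qed.

Definition prime_compl (P : set A) (primeP : prime_ideal P) : multset A :=
  MultSet (prime_compl1 primeP) (prime_complM primeP) (prime_compl0 primeP).

Lemma lreg0F : ~ GRing.lreg (0 : A).
Proof. by move=> /lreg_neq0/eqP; apply. Qed.

Definition nonzerodivisors : multset A :=
  MultSet (@lreg1 A) (@lregM A) lreg0F.

End Multsets.

Definition loc_at_maximal (A : comNzRingType) (M : set A)
  (maxM : maximal_ideal M) := loc (prime_compl (maximal_prime maxM)).

Definition total_frac (A : comNzRingType) := loc (nonzerodivisors A).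

HB.instance Definition _ (A : comNzRingType) (M : set A)
  (maxM : maximal_ideal M) := GRing.ComAlgebra.on (loc_at_maximal maxM).
HB.instance Definition _ (A : comNzRingType) :=
  GRing.ComAlgebra.on (total_frac A).

Definition tfrac (A : comNzRingType) (y x : A) (x_reg : GRing.lreg x) :
  total_frac A := @loc_frac A (nonzerodivisors A) y x x_reg.

Section IntegralClosure.
Variables (A : comNzRingType) (B : comAlgType A).

Definition integral (x : B) : Prop := integralOver (in_alg B) x.

Definition integral_pred : {pred B} := fun x => `[< integral x >].

Lemma integral_pred_closed : subalg_closed integral_pred.
Proof.
split.
- by apply/asboolP; exact: integral1.
- move=> a x y /asboolP ix /asboolP iy; apply/asboolP.
  rewrite -mulr_algl; apply: integral_add => //.
  by apply: integral_mul => //; exact: (integral_id (in_alg B)).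
- by move=> x y /asboolP ix /asboolP iy; apply/asboolP; exact: integral_mul.
Qed.

HB.instance Definition _ := GRing.isSubalgClosed.Build A B integral_pred
  integral_pred_closed.

Record integral_closure := IntegralClosure {
  ic_val :> B;
  _ : ic_val \in integral_pred
}.

HB.instance Definition _ := [isSub for ic_val].
HB.instance Definition _ := [Choice of integral_closure by <:].
HB.instance Definition _ :=
  [SubChoice_isSubComNzRing of integral_closure by <:].
HB.instance Definition _ :=
  [SubZmodule_isSubLmodule of integral_closure by <:].
HB.instance Definition _ :=
  [SubNzRing_SubLmodule_isSubLalgebra of integral_closure by <:].
HB.instance Definition _ :=
  [SubLalgebra_isSubAlgebra of integral_closure by <:].

End IntegralClosure.

Section Tensor.
Variables (A : comNzRingType) (M N : lmodType A).

Local Notation fr x y := (<< (x, y) >> : {freeg (M * N)%type / int}).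

(* The tensor product over A is built as the free abelian group on M * N modulo
   the balanced biadditive relations; only its additive structure is declared. *)
Inductive tensor_rel : {freeg (M * N)%type / int} -> Prop :=
| TensorRel0 : tensor_rel 0
| TensorRelB u v : tensor_rel u -> tensor_rel v -> tensor_rel (u - v)
| TensorRelDl x x' y : tensor_rel (fr (x + x') y - (fr x y + fr x' y))
| TensorRelDr x y y' : tensor_rel (fr x (y + y') - (fr x y + fr x y'))
| TensorRelZ a x y : tensor_rel (fr (a *: x) y - fr x (a *: y)).

Definition tensor_pred : {pred {freeg (M * N)%type / int}} :=
  fun u => `[< tensor_rel u >].

Lemma tensor_pred_closed : zmod_closed tensor_pred.
Proof.
split; first by apply/asboolP; exact: TensorRel0.
by move=> u v /asboolP ru /asboolP rv; apply/asboolP; exact: TensorRelB.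
Qed.

HB.instance Definition _ := GRing.isZmodClosed.Build _ tensor_pred
  tensor_pred_closed.

Definition tensor : Type := Quotient.quot tensor_pred.

HB.instance Definition _ := GRing.Zmodule.on tensor.

Definition pure_tensor (x : M) (y : N) : tensor :=
  \pi_(Quotient.quot tensor_pred) (fr x y).

End Tensor.

Section LocalRings.
Variable R : comNzRingType.

(* Only the values P 0, ..., P n matter. *)
Definition prime_chain (n : nat) (P : nat -> set R) : Prop :=
  (forall i, (i <= n)%N -> prime_ideal (P i)) /\
  (forall i, (i < n)%N -> P i `<` P i.+1).

Definition krull_dim_eq (d : nat) : Prop :=
  (exists P, prime_chain d P) /\
  (forall n P, prime_chain n P -> (n <= d)%N).

(* x_i is a nonzerodivisor on R/(x_0, ..., x_(i-1)), and R/(s) is nonzero. *)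
Definition regular_sequence (s : seq R) : Prop :=
  (forall i, (i < size s)%N -> forall a,
     ideal_gen [set` take i s] (s`_i * a) -> ideal_gen [set` take i s] a) /\
  ~ ideal_gen [set` s] 1.

Definition depth_eq (m : set R) (d : nat) : Prop :=
  (exists s, [/\ regular_sequence s, [set` s] `<=` m & size s = d]) /\
  (forall s, regular_sequence s -> [set` s] `<=` m -> (size s <= d)%N).

Definition local_ring_with (m : set R) : Prop :=
  maximal_ideal m /\ forall m', maximal_ideal m' -> m' = m.

Definition cohen_macaulay_local : Prop :=
  noetherian R /\ exists m, local_ring_with m /\
    exists d, krull_dim_eq d /\ depth_eq m d.

Definition one_dim_cohen_macaulay_local : Prop :=
  krull_dim_eq 1 /\ cohen_macaulay_local.

End LocalRings.

Section StrictClosure.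
Variable A : comNzRingType.

Definition strict_closure (C : comAlgType A) : set C :=
  [set x : C | pure_tensor x 1 = pure_tensor 1 x :> tensor C C].

(* A is identified with its image in C; for C the integral closure of A in its
   total ring of fractions, the structure map is injective. *)
Definition strictly_closed_in (C : comAlgType A) : Prop :=
  @strict_closure C = range (in_alg C).

End StrictClosure.

Section Arf.
Variable A : comNzRingType.

Definition semi_local_one_dim_cm : Prop :=
  [/\ noetherian A, semi_local A
    & forall (M : set A) (maxM : maximal_ideal M),
        one_dim_cohen_macaulay_local (loc_at_maximal maxM)].

Definition arf_ring : Prop :=
  [/\ semi_local_one_dim_cm,
      (forall I : set A, integrally_closed_ideal I ->
         (exists2 x, I x & GRing.lreg x) -> has_principal_reduction I)
    & (forall (x y z : A) (x_reg : GRing.lreg x),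
         integral (tfrac y x_reg) -> integral (tfrac z x_reg) ->
         exists a : A, tfrac (y * z) x_reg = a%:A)].

End Arf.

(* Main.v *)
Require Import Defs.
From HB Require Import structures.
From mathcomp Require Import all_boot all_order all_algebra.
From mathcomp Require Import boolp classical_sets.
From mathcomp Require Import cardinality generic_quotient freeg ring zify.

(** Write [Q] for the total ring of fractions of [A] and [B] for the integral
    closure of [A] in [Q].

    Arf implies strictly closed.  For [d] regular, [R_d = {w in B | d w in A}] is
    a ring by the second Arf condition.  If [M] is a maximal ideal of [R_d]
    containing a unit of [Q], then [dM] is an integrally closed ideal of [A], and
    a principal reduction of it is generated by some [d1 = d y] with
    [M = y R_{d1}].  Iterating such links from [R_1 = A], finitely many elements
    of [B] end up in some [C = R_{d'}], by the descending chain condition on ideals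
    of [A] containing a fixed regular element.  On the other hand
    [x (x) 1 = 1 (x) x] means that, for some tuple [q = (1, x, ...)] in [B], the
    vector [(x, -1, 0, ...)] is a [B]-combination of [A]-linear relations between
    the entries of [q]; choose the chain so that [C] contains [x] and the finitely
    many coefficients.  Along one link this gives [x = r + y b] with [r] in [R_d]
    and [b] in [C], and the relations for [x] over [R_d] become, after division
    by [y], relations for [b] over [R_{d1}].  By induction [b] lies in [R_{d1}],
    hence [x] lies in [R_d].

    Strictly closed implies Arf.  The second condition is a computation with
    tensors.  For the first one let [x, z] be in an integrally closed ideal [I],
    [x] regular, and [t = z/x].  By the Krull-Akizuki argument, some monic [f] has
    [f(t)] in [xA[t]].  Choose [e] lying in exactly those maximal ideals that do not
    contain [x]; the denominators [g_d = 1 + e t^(d-N) f(t)] then satisfy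
    [W_n = g_d W_(n-d)] for [n] large, where [W_n] is the module of polynomials of
    degree at most [n] in [t].  Hence [p_i = t^i / g_d] is in [B] for [i <= d], and
    [x p_i], [z p_i] are in the strict closure, because [x p_i (x) p_j] depends on
    [i + j] only.  So [y = x g_(d+1) / g_d] is in [A], and [x W_(n+1) = y W_n] says
    that [y] generates a reduction of [(x, z)].  Residue fields may be finite, so no
    linear combination of [x] and [z] need do this; that forms of two consecutive
    degrees without common zeros always exist is the point of the construction. *)

Set Implicit Arguments.
Unset Strict Implicit.
Unset Printing Implicit Defensive.

Import GRing.Theory.

Local Open Scope ring_scope.
Local Open Scope classical_set_scope.

(** * Ideals, localizations and integral elements *)

Section NoetherianIdeals.
Variable A : comNzRingType.
Implicit Types (I J M N P : set A) (x y : A).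

Lemma ideal0 I : is_ideal I -> I 0. Proof. by case. Qed.
Lemma idealD I x y : is_ideal I -> I x -> I y -> I (x + y).
Proof. by case=> _ + _; exact. Qed.
Lemma idealMl I a x : is_ideal I -> I x -> I (a * x).
Proof. by case=> _ _; exact. Qed.
Lemma idealMr I a x : is_ideal I -> I x -> I (x * a).
Proof. by rewrite mulrC; exact: idealMl. Qed.
Lemma idealN I x : is_ideal I -> I x -> I (- x).
Proof. by rewrite -mulN1r; exact: idealMl. Qed.
Lemma idealB I x y : is_ideal I -> I x -> I y -> I (x - y).
Proof. by move=> Iid Ix Iy; exact: idealD Iid Ix (idealN Iid Iy). Qed.
Lemma ideal_sum I (T : Type) (r : seq T) (Q : pred T) (F : T -> A) :
  is_ideal I -> (forall i, Q i -> I (F i)) -> I (\sum_(i <- r | Q i) F i).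
Proof.
move=> Iid IF; apply: (big_ind I) => // [|x y]; first exact: ideal0.
exact: idealD.
Qed.

Lemma ideal_gen_ideal (G : set A) : is_ideal (ideal_gen G).
Proof.
split.
- by move=> J [] [].
- by move=> x y Gx Gy J JG; exact: idealD JG.1 (Gx _ JG) (Gy _ JG).
- by move=> a x Gx J JG; exact: idealMl JG.1 (Gx _ JG).
Qed.

Lemma ideal_genS (G : set A) : G `<=` ideal_gen G.
Proof. by move=> x Gx J [_]; exact. Qed.

Lemma ideal_gen_min (G : set A) J :
  is_ideal J -> G `<=` J -> ideal_gen G `<=` J.
Proof. by move=> Jid GJ x; apply. Qed.

Definition principal (x : A) : set A := [set a * x | a in setT].

Lemma principal_ideal x : is_ideal (principal x).
Proof.
split; first by exists 0; rewrite // mul0r.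
- by move=> _ _ [a _ <-] [b _ <-]; exists (a + b); rewrite // mulrDl.
- by move=> a _ [b _ <-]; exists (a * b); rewrite // mulrA.
Qed.

Lemma principal_id x : principal x x.
Proof. by exists 1; rewrite // mul1r. Qed.

Definition ideal_add I J : set A :=
  [set z | exists x y, [/\ I x, J y & z = x + y]].

Lemma ideal_add_ideal I J : is_ideal I -> is_ideal J -> is_ideal (ideal_add I J).
Proof.
move=> Iid Jid; split.
- by exists 0, 0; split; rewrite ?addr0//; exact: ideal0.
- move=> _ _ [x [y [Ix Jy ->]]] [x' [y' [Ix' Jy' ->]]].
  by exists (x + x'), (y + y'); split; rewrite 1?addrACA//; exact: idealD.
- move=> a _ [x [y [Ix Jy ->]]].
  by exists (a * x), (a * y); split; rewrite ?mulrDr//; exact: idealMl.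
Qed.

Lemma ideal_addl I J : is_ideal J -> I `<=` ideal_add I J.
Proof. by move=> Jid x Ix; exists x, 0; split; rewrite ?addr0//; exact: ideal0. Qed.

Lemma ideal_addr I J : is_ideal I -> J `<=` ideal_add I J.
Proof. by move=> Iid x Ix; exists 0, x; split; rewrite ?add0r//; exact: ideal0. Qed.

Lemma ideal_add_sub I J N : is_ideal N -> I `<=` N -> J `<=` N ->
  ideal_add I J `<=` N.
Proof.
by move=> Nid IN JN _ [x [y [Ix Jy ->]]]; apply: idealD; [|exact: IN|exact: JN].
Qed.

(** Without a maximal member, iterated choice gives a strictly increasing chain in [F]; its union is
    finitely generated, hence contained in one of its terms. *)
Lemma noetherian_max (F : set A -> Prop) : noetherian A ->
  (forall I, F I -> is_ideal I) -> (exists I, F I) ->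
  exists I, F I /\ forall J, F J -> I `<=` J -> J `<=` I.
Proof.
move=> noeth Fid [I0 FI0]; apply: contrapT => nomax.
have step I : exists J, F I -> [/\ F J, I `<=` J & ~ J `<=` I].
  have [FI|] := pselect (F I); last by exists I.
  apply: contrapT => noJ; apply: nomax; exists I; split=> // J FJ IJ.
  by apply: contrapT => nJI; apply: noJ; exists J.
have [f fP] := choice step.
pose K n := iter n f I0.
have FK n : F (K n) by elim: n => //= n /fP[].
have KS n : K n `<=` K n.+1 by have [] := fP _ (FK n).
have Kle m n : (m <= n)%N -> K m `<=` K n.
  move=> /subnK <-; elim: (n - m)%N => [|k IH]; first by rewrite add0n.
  by rewrite addSn; apply: subset_trans (KS _).
pose U : set A := [set x | exists n, K n x].
have Uid : is_ideal U.
  split; first by exists 0%N; apply: ideal0; exact: Fid.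
  - move=> x y [m Kx] [n Ky]; exists (maxn m n).
    apply: idealD; first exact: Fid.
      exact: Kle (leq_maxl _ _) _ Kx.
    exact: Kle (leq_maxr _ _) _ Ky.
  - by move=> a x [n Kx]; exists n; apply: idealMl; [exact: Fid|].
have [s Us] := noeth U Uid.
have [n sK] : exists n, [set` s] `<=` K n.
  have : [set` s] `<=` U by rewrite Us; exact: ideal_genS.
  elim: s {Us} => [|x s IH] sU; first by exists 0%N.
  have [|n sK] := IH; first by move=> y ys; apply: sU; rewrite /= inE ys orbT.
  have [|m Kx] := sU x; first by rewrite /= inE eqxx.
  exists (maxn m n) => y /=; rewrite inE => /orP[/eqP->|/sK].
    exact: Kle (leq_maxl _ _) _ Kx.
  exact: Kle (leq_maxr _ _) _.
have [_ _] := fP _ (FK n); apply=> x Kx.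
have : U x by exists n.+1.
rewrite Us => /ideal_gen_min; apply=> //; exact: Fid.
Qed.

Lemma sub_maximal I : noetherian A -> is_ideal I -> ~ I 1 ->
  exists M, maximal_ideal M /\ I `<=` M.
Proof.
move=> noeth Iid I1.
have [||M [[Mid M1 IM] Mmax]] :=
  @noetherian_max (fun J => [/\ is_ideal J, ~ J 1 & I `<=` J]) noeth.
- by move=> J [].
- by exists I; split.
- exists M; split=> //; split=> // J Jid J1 MJ; apply/seteqP; split=> //.
  by apply: Mmax => //; split=> //; exact: subset_trans IM MJ.
Qed.

Lemma maximal_inv M x : maximal_ideal M -> ~ M x -> exists r, M (1 - r * x).
Proof.
move=> [Mid M1 Mmax] nMx.
have Jid := ideal_add_ideal Mid (principal_ideal x).
have [[m [_ [Mm [r _ <-] e]]]|J1] := pselect (ideal_add M (principal x) 1).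
  by exists r; rewrite e addrK.
exfalso; apply: nMx; rewrite -(Mmax _ Jid J1 (ideal_addl (principal_ideal x))).
exact: ideal_addr (principal_id x).
Qed.

Lemma not_sub_maximal1 I : noetherian A -> is_ideal I ->
  (forall M, maximal_ideal M -> exists2 x, I x & ~ M x) -> I 1.
Proof.
move=> noeth Iid IM; apply: contrapT => I1.
have [M [Mmax IsM]] := sub_maximal noeth Iid I1.
by have [x Ix []] := IM _ Mmax; exact: IsM.
Qed.

(* Noetherian induction on a common lower bound [R] of the family: if [R] is
   maximal among the bad bounds, choose [b] outside [R] with [(R : b)] maximal
   and compare each ideal [I] of the family with [I + bA]. *)
Lemma ideals_dcc x : noetherian A ->
  (forall P, prime_ideal P -> P x -> maximal_ideal P) ->
  forall F : set A -> Prop, (forall I, F I -> is_ideal I /\ I x) ->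
  (exists I, F I) -> exists I, F I /\ forall J, F J -> J `<=` I -> I `<=` J.
Proof.
move=> noeth Pmax F0 F0id F0ex.
pose good R := forall F : set A -> Prop,
  (forall I, F I -> is_ideal I /\ R `<=` I) -> (exists I, F I) ->
  exists I, F I /\ forall J, F J -> J `<=` I -> I `<=` J.
suff: good (principal x).
  apply=> // I /F0id[Iid Ix]; split=> // _ [a _ <-]; exact: idealMl.
apply: contrapT => bad.
have [||R [[Rid Rx badR] Rmax]] :=
  @noetherian_max (fun R => [/\ is_ideal R, R x & ~ good R]) noeth.
- by move=> J [].
- exists (principal x); split=> //; [exact: principal_ideal|exact: principal_id].
have goodR J : is_ideal J -> R `<=` J -> ~ J `<=` R -> good J.
  move=> Jid RJ nJR; apply: contrapT => bJ; apply: nJR; apply: Rmax => //.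
  by split=> //; exact: RJ.
have R1 : ~ R 1.
  move=> R1; apply: badR => F Fid [I FI]; exists I; split=> // J FJ _ y _.
  have [Jid RJ] := Fid _ FJ; rewrite -[y]mulr1.
  by apply: idealMl => //; exact: RJ.
pose colon b : set A := [set a | R (a * b)].
have colon_id b : is_ideal (colon b).
  split; first by rewrite /colon /= mul0r; exact: ideal0.
  - by move=> a c Ra Rc; rewrite /colon /= mulrDl; exact: idealD.
  - by move=> a c Rc; rewrite /colon /= -mulrA; exact: idealMl.
have [||_ [[b [-> nRb]] bmax]] :=
  @noetherian_max (fun J => exists b, J = colon b /\ ~ R b) noeth.
- by move=> _ [b [-> _]].
- by exists (colon 1), 1.
(* As for associated primes, a maximal colon ideal is prime; it contains [x] because [R] does. *)
have Mmax : maximal_ideal (colon b).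
  apply: Pmax; last by rewrite /colon /= mulrC; exact: idealMl.
  split; [exact: colon_id|by rewrite /colon /= mul1r|move=> u v Ruv].
  have [|nRv] := pselect (R (v * b)); first by right.
  left; apply: (bmax (colon (v * b))); [by exists (v * b)| |].
    by move=> a Ra; rewrite /colon /= mulrCA; exact: idealMl.
  by rewrite /colon /= mulrA.
apply: badR => F Fid [I1 FI1].
pose ext I := ideal_add I (principal b).
have ext_id I : is_ideal I -> is_ideal (ext I).
  by move=> Iid; exact: ideal_add_ideal (principal_ideal b).
have Isub I : I `<=` ext I by exact: ideal_addl (principal_ideal b).
have extb I : is_ideal I -> ext I b.
  by move=> Iid; exact: ideal_addr (principal_id b).
have Rb_id := ext_id _ Rid.
have [|||_ [[I0 [FI0 ->]] I0min]] :=
  goodR _ Rb_id (@Isub R) _ (fun J => exists I, F I /\ J = ext I).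
- by move/(_ b (extb _ Rid)).
- move=> _ [I [FI ->]]; have [Iid RI] := Fid _ FI; split; first exact: ext_id.
  apply: ideal_add_sub; first exact: ext_id.
    exact: subset_trans RI (Isub _).
  by move=> _ [a _ <-]; apply: idealMl; [exact: ext_id|exact: extb].
- by exists (ext I1), I1.
have [I0id RI0] := Fid _ FI0.
(* If [I] misses [b], then [I] meets [bA] inside [R], because [(R : b)] is maximal; so a smaller [J]
   with the same sum with [bA] equals [I]. If no such [I] misses [b], each of them is its own sum
   with [bA], and [I0] is minimal. *)
have [[I [FI II0 nIb]]|allb] :=
    pselect (exists I, [/\ F I, ext I `<=` ext I0 & ~ I b]).
  exists I; split=> // J FJ JI a Ia; have [Iid RI] := Fid _ FI.
  have [Jid RJ] := Fid _ FJ.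
  have JI0 : ext J `<=` ext I0.
    apply: subset_trans II0; apply: ideal_add_sub; first exact: ext_id.
      exact: subset_trans JI (Isub _).
    by move=> _ [c _ <-]; apply: idealMl; [exact: ext_id|exact: extb].
  have [] : ext J a by apply: (I0min (ext J)) => //; [exists J|exact/II0/Isub].
  move=> c [_ [Jc [r _ <-] e]]; rewrite e; apply: idealD => //; apply: RJ.
  apply: contrapT => nRrb; have [s] := maximal_inv Mmax nRrb.
  rewrite /colon /= mulrBl mul1r => Rs; apply: nIb.
  have -> : b = (b - s * r * b) + s * (a - c) by rewrite e; ring.
  apply: idealD => //; first exact: RI.
  by apply: idealMl => //; apply: idealB => //; exact: JI.
exists I0; split=> // J FJ JI; have [Jid RJ] := Fid _ FJ.
have JI0 : ext J `<=` ext I0.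
  apply: ideal_add_sub; first exact: ext_id.
    exact: subset_trans JI (Isub _).
  by move=> _ [c _ <-]; apply: idealMl; [exact: ext_id|exact: extb].
have Jb : J b by apply: contrapT => nJb; apply: allb; exists J.
move=> a I0a; have [] : ext J a.
  by apply: (I0min (ext J)) => //; [exists J|exact: Isub].
move=> c [_ [Jc [r _ <-] ->]]; apply: idealD => //; exact: idealMl.
Qed.

End NoetherianIdeals.

(** * Primes containing a regular element are maximal *)

Section PrimesOverRegular.
Variable A : comNzRingType.

Section Fractions.
Variable S : multset A.

Lemma loc_fracP (w : loc S) : exists a s (Ss : S s), w = loc_frac a Ss.
Proof.
elim/quotW: w => -[a s]; exists a, (sval s), (denomP s).
by congr (\pi_(loc S) (_, _))%qT; apply: val_inj.
Qed.

Lemma loc_frac_eq a b s t (Ss : S s) (St : S t) :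
  loc_frac a Ss = loc_frac b St <-> exists2 u, S u & u * (a * t - b * s) = 0.
Proof. by split=> [/loc_piP/asboolP|e]; [|apply/loc_piP/asboolP]. Qed.

Lemma loc_fracD a b s t (Ss : S s) (St : S t) :
  loc_frac a Ss + loc_frac b St
  = loc_frac (a * t + b * s) (multsetM Ss St).
Proof. by rewrite -[LHS]/(loc_add _ _) loc_addE; exact: loc_pi_eq. Qed.

Lemma loc_fracM a b s t (Ss : S s) (St : S t) :
  loc_frac a Ss * loc_frac b St = loc_frac (a * b) (multsetM Ss St).
Proof. by rewrite -[LHS]/(loc_mul _ _) loc_mulE; exact: loc_pi_eq. Qed.

Definition loc_ideal (I : set A) : set (loc S) :=
  [set w | exists a s (Ss : S s), I a /\ w = loc_frac a Ss].

Lemma loc_ideal_frac I a s (Ss : S s) : prime_ideal I ->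
  (forall t, S t -> ~ I t) -> loc_ideal I (loc_frac a Ss) <-> I a.
Proof.
move=> [Iid I1 IM] IS; split; last by move=> Ia; exists a, s, Ss.
move=> [b [t [St [Ib /loc_frac_eq[u Su /eqP]]]]].
rewrite mulrBr subr_eq0 => /eqP e.
have : I (u * (a * t)) by rewrite e; apply: (idealMl _ Iid); exact: idealMr.
by case/IM => [/IS//|/IM[//|/IS]].
Qed.

Lemma loc_prime I : prime_ideal I -> (forall t, S t -> ~ I t) ->
  prime_ideal (loc_ideal I).
Proof.
move=> Ipr IS; have [Iid I1 IM] := Ipr; split.
- split; first by exists 0, 1, (multset1 S); split=> //; exact: ideal0.
  + move=> _ _ [a [s [Ss [Ia ->]]]] [b [t [St [Ib ->]]]]; rewrite loc_fracD.
    by apply/loc_ideal_frac => //; apply: idealD => //; exact: idealMr.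
  + move=> w _ [a [s [Ss [Ia ->]]]]; have [b [t [St ->]]] := loc_fracP w.
    by rewrite loc_fracM; apply/loc_ideal_frac => //; exact: idealMl.
- by rewrite -[1]/(loc_frac 1 (multset1 S)) loc_ideal_frac.
- move=> v w; have [a [s [Ss ->]]] := loc_fracP v.
  have [b [t [St ->]]] := loc_fracP w.
  by rewrite loc_fracM !loc_ideal_frac//; exact: IM.
Qed.

End Fractions.

(** [Q] is maximal among the ideals disjoint from the multiplicative set of the [s x^n] with [s]
    outside [P]; this set omits [0] because [x] is regular. *)
Lemma prime_avoiding_powers (P : set A) x : noetherian A ->
  GRing.lreg x -> prime_ideal P -> exists Q, [/\ prime_ideal Q, Q `<=` P & ~ Q x].
Proof.
move=> noeth xreg [Pid P1 PM].
have [||Q [[Qid QP] Qmax]] := @noetherian_max A (fun J =>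
  is_ideal J /\ forall s n, ~ P s -> ~ J (s * x ^+ n)) noeth.
- by move=> J [].
- exists (principal 0); split; first exact: principal_ideal.
  move=> s n nPs [a _]; rewrite mulr0 mulrC => /esym.
  rewrite -[RHS](mulr0 (x ^+ n)) => /(lregX xreg) s0.
  by apply: nPs; rewrite s0; exact: ideal0.
exists Q; split; last by rewrite -[x]mul1r; exact: (QP 1 1%N).
  split=> //; first by have := QP 1 0%N P1; rewrite mulr1.
  move=> u v Quv; apply: contrapT => /not_orP[nQu nQv].
  have meet w : ~ Q w -> exists s n r, ~ P s /\ Q (s * x ^+ n - r * w).
    move=> nQw; have Jid := ideal_add_ideal Qid (principal_ideal w).
    have : ~ (forall s n, ~ P s -> ~ ideal_add Q (principal w) (s * x ^+ n)).
      move=> J; apply: nQw; apply: (Qmax (ideal_add Q (principal w))) => //.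
        exact: ideal_addl (principal_ideal w).
      exact: ideal_addr (principal_id w).
    move=> /existsNP[s] /existsNP[n] /not_implyP[nPs] /contrapT.
    move=> [p [_ [Qp [r _ <-] e]]]; exists s, n, r; split=> //.
    by rewrite e addrK.
  have [s [n [r [nPs Qs]]]] := meet _ nQu; have [t [m [q [nPt Qt]]]] := meet _ nQv.
  apply: (QP (s * t) (n + m)%N); first by case/PM.
  have -> : s * t * x ^+ (n + m) =
      t * x ^+ m * (s * x ^+ n - r * u) + r * u * (t * x ^+ m - q * v)
      + r * q * (u * v) by rewrite exprD; ring.
  by do 2?apply: idealD => //; exact: idealMl.
move=> a Qa; apply: contrapT => nPa; apply: (QP a 0%N nPa).
by rewrite expr0 mulr1.
Qed.

(** If [P] were strictly below a maximal ideal [M], then [Q < P < M], with [Q] avoiding [x], would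
    be a chain of length two in the localization at [M]. *)
Lemma prime_regular_maximal (P : set A) x : semi_local_one_dim_cm A ->
  GRing.lreg x -> prime_ideal P -> P x -> maximal_ideal P.
Proof.
move=> [noeth _ dim1] xreg Ppr Px; have [Pid P1 _] := Ppr.
have [M [Mmax PM]] := sub_maximal noeth Pid P1.
suff -> : P = M by [].
apply/seteqP; split=> // z Mz; apply: contrapT => nPz.
have [Q [Qpr QP nQx]] := prime_avoiding_powers noeth xreg Ppr.
have Mpr := maximal_prime Mmax.
have [[_ dimle] _] := dim1 _ Mmax.
pose S := prime_compl (maximal_prime Mmax).
pose C n : set (loc S) :=
  loc_ideal (if n is n'.+1 then if n' is 0 then P else M else Q).
suff : prime_chain 2 C by move/dimle.
split=> [[|[|[|//]]] _|[|[|//]] _].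
- by apply: loc_prime => // t nMt /QP/PM.
- by apply: loc_prime => // t nMt /PM.
- by apply: loc_prime.
- split.
    by move=> _ [a [s [Ss [Qa ->]]]]; exists a, s, Ss; split=> //; exact: QP.
  move=> /(_ (loc_frac x (multset1 S))); rewrite /C !loc_ideal_frac//.
  + by move=> /(_ Px).
  + by move=> t nMt /QP/PM.
  + by move=> t nMt /PM.
- split.
    by move=> _ [a [s [Ss [Qa ->]]]]; exists a, s, Ss; split=> //; exact: PM.
  move=> /(_ (loc_frac z (multset1 S))); rewrite /C !loc_ideal_frac//.
  + by move=> /(_ Mz).
  + by move=> t nMt /PM.
Qed.

End PrimesOverRegular.

(** * Integral elements of a ring of fractions *)

Section FractionRing.
Variables (A : comNzRingType) (Q : comAlgType A).
Implicit Types (a b d : A) (t u v w : Q).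

(** These properties of the total ring of fractions let the arguments compute in [Q] without
    representatives of fractions. *)
Record fraction_ring : Prop := FractionRing {
  fraction_inj : injective (in_alg Q);
  fraction_inv : forall d, GRing.lreg d -> exists v, d%:A * v = 1;
  fraction_denom : forall w, exists d a, GRing.lreg d /\ d%:A * w = a%:A
}.

Lemma algD a b : (a + b)%:A = a%:A + b%:A :> Q. Proof. exact: scalerDl. Qed.
Lemma algN a : (- a)%:A = - a%:A :> Q. Proof. exact: scaleNr. Qed.
Lemma algM a b : (a * b)%:A = a%:A * b%:A :> Q.
Proof. by rewrite mulr_algl scalerA. Qed.
Lemma alg1 : 1%:A = 1 :> Q. Proof. exact: scale1r. Qed.
Lemma alg0 : 0%:A = 0 :> Q. Proof. exact: scale0r. Qed.
Lemma algX a n : (a ^+ n)%:A = a%:A ^+ n :> Q.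
Proof. exact: (rmorphXn (in_alg Q)). Qed.
Lemma alg_sum (I : Type) (r : seq I) (P : pred I) (F : I -> A) :
  (\sum_(i <- r | P i) F i)%:A = \sum_(i <- r | P i) (F i)%:A :> Q.
Proof. exact: (rmorph_sum (in_alg Q)). Qed.

Lemma integral_alg a : integral (a%:A : Q).
Proof. exact: (integral_id (in_alg Q)). Qed.
Lemma integralD u v : integral u -> integral v -> integral (u + v).
Proof. exact: integral_add. Qed.
Lemma integralM u v : integral u -> integral v -> integral (u * v).
Proof. exact: integral_mul. Qed.
Lemma integralN u : integral u -> integral (- u).
Proof. exact: integral_opp. Qed.
Lemma integral_sum (I : Type) (r : seq I) (P : pred I) (F : I -> Q) :
  (forall i, P i -> integral (F i)) -> integral (\sum_(i <- r | P i) F i).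
Proof.
move=> iF; apply: (big_ind (@integral A Q)) => //; last exact: integralD.
by rewrite -alg0; exact: integral_alg.
Qed.

Lemma integral_of_eq t n (c : nat -> Q) :
  (forall i, (i < n)%N -> integral (c i)) ->
  t ^+ n = \sum_(i < n) c i * t ^+ i -> integral t.
Proof.
move=> ic e; pose q : {poly Q} := \poly_(i < n) c i.
have sq : (size q < size ('X^n : {poly Q}))%N.
  by rewrite size_polyXn ltnS size_poly.
apply: (@integral_root_monic _ _ (in_alg Q) t ('X^n - q)).
- by rewrite monicE lead_coefDl ?size_polyN// lead_coefXn.
- by rewrite /root !hornerE horner_poly e subrr.
- apply/integral_poly => i; rewrite coefB coefXn coef_poly.
  apply: integral_sub; first exact: (integral_nat (in_alg Q)).
  by case: ifP => [/ic//|_]; exact: (integral0 (in_alg Q)).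
Qed.

(** The ideals generated by the initial segments of the sequence stabilize. *)
Lemma noetherian_seq (a : nat -> A) : noetherian A ->
  exists n (r : nat -> A), a n = \sum_(i < n) r i * a i.
Proof.
move=> noeth.
pose G n := [set z | exists r : nat -> A, z = \sum_(i < n) r i * a i].
have [||_ [[n ->] Gmax]] := @noetherian_max A (fun J => exists n, J = G n) noeth.
- move=> _ [n ->]; split.
  + by exists (fun=> 0); rewrite big1// => i _; rewrite mul0r.
  + move=> _ _ [r ->] [s ->]; exists (fun i => r i + s i).
    by rewrite -big_split; apply: eq_bigr => i _; rewrite mulrDl.
  + move=> c _ [r ->]; exists (fun i => c * r i).
    by rewrite mulr_sumr; apply: eq_bigr => i _; rewrite mulrA.
- by exists (G 0%N), 0%N.
have [|||r e] := Gmax (G n.+1) _ _ (a n); first by exists n.+1.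
- move=> _ [r ->]; exists (fun i => if i == n then 0 else r i).
  rewrite big_ord_recr /= eqxx mul0r addr0; apply: eq_bigr => i _.
  by rewrite ltn_eqF.
- exists (fun i => (i == n)%:R).
  rewrite big_ord_recr /= eqxx mul1r big1 ?add0r// => i _.
  by rewrite ltn_eqF// mul0r.
- by exists n, r.
Qed.

Lemma unit_cancel u v : (exists v', u * v' = 1) -> u * v = 0 -> v = 0.
Proof. by move=> [v' e] e'; rewrite -[v]mul1r -e mulrAC e' mul0r. Qed.

Lemma unit_inj u : (exists v', u * v' = 1) -> injective ( *%R u).
Proof.
move=> [v' e] v w /(congr1 ( *%R v')).
by rewrite !mulrA [v' * u]mulrC e !mul1r.
Qed.

Hypotheses (noeth : noetherian A) (frac : fraction_ring).

(** Some numerator [d t^n] is an [A]-combination of the previous ones; cancelling [d] leaves a monic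
    equation for [t]. *)
Lemma integral_of_bounded d t : GRing.lreg d ->
  (forall k, exists a, d%:A * t ^+ k = a%:A) -> integral t.
Proof.
move=> dreg /choice[a aP]; have [n [r e]] := noetherian_seq a noeth.
apply: (@integral_of_eq t n (fun i => (r i)%:A)) => [i _|]; first exact: integral_alg.
apply: (unit_inj (fraction_inv frac dreg)); rewrite /= aP.
rewrite e alg_sum mulr_sumr; apply: eq_bigr => i _.
by rewrite algM -aP mulrCA.
Qed.

Lemma alg_lreg a v : a%:A * v = 1 -> GRing.lreg a.
Proof.
move=> av b c /(congr1 (in_alg Q))/(congr1 ( *%R v)) /=.
by rewrite !algM !mulrA [v * _]mulrC av !mul1r => /(fraction_inj frac).
Qed.

(** A monic equation of [v], multiplied by a suitable power of [u], expresses [v] as a polynomial in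
    [u]. *)
Lemma inv_integral u v : u * v = 1 -> integral v ->
  exists n (r : nat -> A), v = \sum_(i < n) (r i)%:A * u ^+ i.
Proof.
move=> uv [p pmon /rootP]; rewrite horner_coef size_map_poly_id0; last first.
  by rewrite (monicP pmon) rmorph1 oner_eq0.
have := monic_neq0 pmon; rewrite -size_poly_gt0.
case es : (size p) => [//|n] _; rewrite big_ord_recr /= coef_map /=.
have -> : p`_n = 1 by have := monicP pmon; rewrite lead_coefE es.
rewrite alg1 mul1r addrC => /eqP; rewrite addr_eq0 => /eqP e.
have uvX k : u ^+ k * v ^+ k = 1 by rewrite -exprMn uv expr1n.
exists n, (fun i => - p`_(n - i.+1)).
have -> : v = u ^+ n * v ^+ n.+1 by rewrite exprSr mulrA uvX mul1r.
rewrite exprS e mulrCA mulrN mulr_sumr mulrN mulr_sumr -sumrN.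
rewrite (reindex_inj rev_ord_inj) /=; apply: eq_bigr => i _.
rewrite coef_map /= algN mulNr; congr (- _).
have -> : u ^+ n = u ^+ i * (u * u ^+ (n - i.+1)).
  by rewrite -exprS -exprD subnSK// subnKC// ltnW.
move: (uvX (n - i.+1)%N); move: (u ^+ (n - _)) (v ^+ (n - _)) => x y xy.
by transitivity ((p`_(n - i.+1))%:A * u ^+ i * (u * v) * (x * y));
  [ring|rewrite uv xy !mulr1].
Qed.

End FractionRing.

(** * Arf rings are strictly closed *)

Section IdealPowers.
Variable A : comNzRingType.
Implicit Types (I J N : set A).

Lemma ideal_mul_ideal I J : is_ideal (ideal_mul I J).
Proof. exact: ideal_gen_ideal. Qed.

Lemma ideal_mulP I J x y : I x -> J y -> ideal_mul I J (x * y).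
Proof. by move=> Ix Jy; apply: ideal_genS; exists x, y. Qed.

Lemma ideal_mul_min I J N : is_ideal N ->
  (forall x y, I x -> J y -> N (x * y)) -> ideal_mul I J `<=` N.
Proof.
by move=> Nid IJN; apply: ideal_gen_min => // _ [x [y [Ix Jy ->]]]; exact: IJN.
Qed.

Lemma setT_ideal : is_ideal (setT : set A). Proof. by []. Qed.

Lemma ideal_pow_ideal I n : is_ideal (ideal_pow I n).
Proof. by case: n => [|n]; [exact: setT_ideal|exact: ideal_mul_ideal]. Qed.

Lemma ideal_powX I x n : I x -> ideal_pow I n (x ^+ n).
Proof. by move=> Ix; elim: n => //= n IH; rewrite exprS; exact: ideal_mulP. Qed.

Lemma ideal_pow1 I : is_ideal I -> ideal_pow I 1 = I.
Proof.
move=> Iid; apply/seteqP; split=> [|x Ix].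
  by apply: ideal_mul_min => // x y Ix _; exact: idealMr.
by rewrite -[x]mulr1; exact: ideal_mulP.
Qed.

Lemma sub_integral_closure I : is_ideal I -> I `<=` ideal_integral_closure I.
Proof.
move=> Iid x Ix; exists 1%N, (fun=> - x); split.
  case=> [|[|i]] // _; rewrite ideal_pow1//; exact: idealN.
by rewrite big_nat1 subnn mulr1 expr1 subrr.
Qed.

End IdealPowers.

(** * The rings [R_d] and the links between them *)

Section Overrings.
Variables (A : comNzRingType) (Q : comAlgType A).
Hypotheses (noeth : noetherian A) (frac : fraction_ring Q).
Implicit Types (a b d : A) (t u v w y : Q).

(* The ring obtained from [A] by dividing by [d] the elements of [A] that
   are divisible by [d] in the integral closure. *)
Definition overring d : set Q :=
  [set w | integral w /\ exists a, d%:A * w = a%:A].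

Definition in_ideal y : set Q := [set w | exists2 b, integral b & w = y * b].

(** The last clause says that the quotient of [overring d] by its trace of [yB] is a field or
    zero. *)
Definition maximal_link d d1 y :=
  [/\ overring d y, d1%:A = d%:A * y :> Q &
    forall r, overring d r ->
      in_ideal y r \/ exists2 r', overring d r' & in_ideal y (1 - r * r')].

(** The second Arf condition, with [u = y/x] and [v = z/x], so that [x(uv) = yz/x]. *)
Definition divided_products := forall (x y z : A) (u v : Q), GRing.lreg x ->
  x%:A * u = y%:A -> x%:A * v = z%:A -> integral u -> integral v ->
  exists a, x%:A * (u * v) = a%:A.

Lemma overring_alg d a : overring d (a%:A).
Proof. by split; [exact: integral_alg|exists (d * a); rewrite algM]. Qed.

Lemma overring1 d : overring d 1.
Proof. by rewrite -(alg1 Q); exact: overring_alg. Qed.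

Lemma overringD d u v : overring d u -> overring d v -> overring d (u + v).
Proof.
move=> [iu [a ea]] [iv [b eb]]; split; first exact: integralD.
by exists (a + b); rewrite mulrDr ea eb algD.
Qed.

Lemma overringN d u : overring d u -> overring d (- u).
Proof.
move=> [iu [a ea]]; split; first exact: integralN.
by exists (- a); rewrite mulrN ea algN.
Qed.

Lemma overringB d u v : overring d u -> overring d v -> overring d (u - v).
Proof. by move=> du dv; exact: overringD du (overringN dv). Qed.

Hypothesis dprod : divided_products.

Lemma overringM d u v : GRing.lreg d ->
  overring d u -> overring d v -> overring d (u * v).
Proof.
move=> dreg [iu [a ea]] [iv [b eb]]; split; first exact: integralM.
exact: dprod dreg ea eb iu iv.
Qed.

Lemma overringX d u n : GRing.lreg d -> overring d u -> overring d (u ^+ n).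
Proof.
move=> dreg du; elim: n => [|n IH]; first exact: overring1.
by rewrite exprS; exact: overringM.
Qed.

Lemma overring_sum d (I : Type) (r : seq I) (P : pred I) (F : I -> Q) :
  (forall i, P i -> overring d (F i)) -> overring d (\sum_(i <- r | P i) F i).
Proof.
move=> dF; apply: (big_ind (overring d)) => //; last exact: overringD.
by rewrite -(alg0 Q); exact: overring_alg.
Qed.

Section Link.
Variables (d : A) (c : Q).
Hypotheses (dreg : GRing.lreg d) (dc : overring d c)
  (cunit : exists c', c * c' = 1)
  (cninv : ~ exists2 u, overring d u & c * u = 1).
Hypothesis reductions : forall I : set A, integrally_closed_ideal I ->
  (exists2 x, I x & GRing.lreg x) -> has_principal_reduction I.

Let dK : injective ( *%R (d%:A : Q)).
Proof. exact: unit_inj (fraction_inv frac dreg). Qed.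

(** These are the [dM] for proper ideals [M] of [overring d] containing [c]. Passing to numerators
    gives ideals of [A], where the Noetherian hypothesis applies. *)
Let proper J := [/\ is_ideal J,
  forall a, J a -> exists2 w, overring d w & a%:A = d%:A * w,
  forall a b r, J a -> overring d r -> b%:A = a%:A * r -> J b,
  forall a, a%:A = d%:A * c -> J a & ~ J d].

Lemma overring_maximal : exists M : set Q, [/\
  is_ideal [set a : A | exists2 w, M w & a%:A = d%:A * w],
  M `<=` overring d,
  forall w r, M w -> overring d r -> M (w * r), M c /\ ~ M 1
  & forall r, overring d r -> M r \/ exists2 r', overring d r' & M (1 - r * r')].
Proof.
have [||J [[Jid Jd JM Jc nJd] Jmax]] := @noetherian_max A proper noeth.
- by move=> J [].
(* [d c R_d] omits [d], because [c] has no inverse in [R_d]. *)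
- pose J0 := [set a | exists2 r, overring d r & a%:A = d%:A * c * r].
  exists J0; split.
  + split.
    * by exists 0; rewrite ?mulr0 ?alg0// -(alg0 Q); exact: overring_alg.
    * move=> a b [r dr ea] [s ds eb]; exists (r + s); first exact: overringD.
      by rewrite algD ea eb mulrDr.
    * move=> b a [r dr ea]; exists (b%:A * r).
        by apply: overringM => //; exact: overring_alg.
      by rewrite algM ea mulrCA.
  + by move=> a [r dr ->]; exists (c * r); [exact: overringM|rewrite mulrA].
  + move=> a b r [s ds ea] dr eb; exists (s * r); first exact: overringM.
    by rewrite eb ea !mulrA.
  + by move=> a ea; exists 1; rewrite ?mulr1//; exact: overring1.
  + move=> [r dr e]; apply: cninv; exists r => //.
    by apply: dK; rewrite /= mulr1 mulrA -e.
pose M := [set w | overring d w /\ exists2 a, J a & a%:A = d%:A * w].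
have JE : J = [set a : A | exists2 w, M w & a%:A = d%:A * w].
  apply/seteqP; split=> [a Ja|a [w [_ [b Jb eb]] ea]].
    by have [w dw ea] := Jd _ Ja; exists w => //; split=> //; exists a.
  by have -> : a = b by apply: (fraction_inj frac); rewrite /= ea eb.
have MM w r : M w -> overring d r -> M (w * r).
  move=> [dw [a Ja ea]] dr; split; first exact: overringM.
  have [_ [b eb]] := overringM dreg dw dr; exists b => //.
  by apply: (JM a b r) => //; rewrite ea -eb mulrA.
exists M; split=> //.
- by rewrite -JE.
- by move=> w [].
- split; first by split=> //; have [_ [a ea]] := dc; exists a => //; exact: Jc.
  move=> [_ [a Ja]]; rewrite mulr1 => /(fraction_inj frac) e.
  by apply: nJd; rewrite -e.
move=> r dr; have [|nMr] := pselect (M r); [by left|right].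
(* [J + d r R_d]: if it contains [d], then [r] is invertible modulo [M]; otherwise maximality of [J]
   puts [r] in [M]. *)
pose J1 := [set a | exists2 j, J j & exists2 s, overring d s &
  a%:A = j%:A + d%:A * (r * s)].
have [J1d|nJ1d] := pselect (J1 d).
  have [j Jj [s ds e]] := J1d; exists s => //; split.
    by apply: overringB; [exact: overring1|exact: overringM].
  by exists j => //; rewrite mulrBr mulr1 {1}e addrK.
exfalso; apply: nMr; split=> //; have [_ [b eb]] := dr; exists b => //.
have d0 : overring d 0 by rewrite -(alg0 Q); exact: overring_alg.
apply: (Jmax J1).
- split=> //.
  + split.
    * by exists 0; [exact: ideal0|exists 0]; rewrite ?mulr0 ?addr0.
    * move=> a a' [j Jj [s ds ea]] [j' Jj' [s' ds' ea']].
      exists (j + j'); first exact: idealD.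
      by exists (s + s'); [exact: overringD|rewrite !algD ea ea'; ring].
    * move=> x a [j Jj [s ds ea]]; exists (x * j); first exact: idealMl.
      exists (x%:A * s); last by rewrite !algM ea; ring.
      by apply: overringM => //; exact: overring_alg.
  + move=> a [j /Jd[w dw ->] [s ds ->]]; exists (w + r * s).
      by apply: overringD => //; exact: overringM.
    by rewrite mulrDr.
  + move=> a a' q [j Jj [s ds ea]] dq ea'; have [w dw ej] := Jd _ Jj.
    have [_ [j' ej']] := overringM dreg dw dq.
    exists j'; first by apply: (JM j j' q) => //; rewrite ej -ej' mulrA.
    by exists (s * q); [exact: overringM|rewrite ea' ea -ej' ej; ring].
  + move=> a ea; exists a; first exact: Jc.
    by exists 0 => //; rewrite !mulr0 addr0.
- by move=> a Ja; exists a => //; exists 0; rewrite ?mulr0 ?addr0.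
- exists 0; first exact: ideal0.
  by exists 1; [exact: overring1|rewrite alg0 add0r mulr1 eb].
Qed.

(** For [M] maximal in [overring d] and containing [c], the ideal [J = dM] of [A] is integrally
    closed. The generator of a principal reduction of it is [d1 = d y]. *)
Lemma exists_maximal_link : exists d1 y, [/\ GRing.lreg d1,
  maximal_link d d1 y, in_ideal y c & ~ in_ideal y 1].
Proof.
have [M [Jid Md MM [Mc nM1] Mmax]] := overring_maximal.
pose J := [set a : A | exists2 w, M w & a%:A = d%:A * w].
have MD u v : M u -> M v -> M (u + v).
  move=> Mu Mv; have [_ [a ea]] := Md _ Mu; have [_ [b eb]] := Md _ Mv.
  have [] := idealD (x := a) (y := b) Jid; [by exists u|by exists v|].
  by move=> w Mw; rewrite algD -ea -eb -mulrDr => /dK ->.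
have M0 : M 0.
  by have := MM _ _ Mc (overring_alg d 0); rewrite alg0 mulr0.
have Mprime u n : overring d u -> M (u ^+ n) -> M u.
  move=> du; have [//|[r dr Mr]] := Mmax _ du.
  elim: n => [/nM1//|n IH] Mu; apply: IH.
  have -> : u ^+ n = (1 - u * r) * u ^+ n + u ^+ n.+1 * r by rewrite exprS; ring.
  by apply: MD; apply: MM => //; exact: overringX.
have Jpow i x : ideal_pow J i.+1 x -> exists2 w, M w & x%:A = d%:A ^+ i.+1 * w.
  elim: i x => [|i IH] x.
    by rewrite ideal_pow1// => -[w Mw e]; exists w.
  move: x; rewrite -[ideal_pow J i.+2]/(ideal_mul J (ideal_pow J i.+1)).
  apply: ideal_mul_min.
    split; first by exists 0; rewrite // alg0 mulr0.
    - move=> a b [w Mw ea] [w' Mw' eb]; exists (w + w'); first exact: MD.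
      by rewrite algD ea eb mulrDr.
    - move=> b a [w Mw ea]; exists (w * b%:A); last by rewrite algM ea; ring.
      by apply: MM => //; exact: overring_alg.
  move=> a b [u Mu ea] /IH[v Mv eb]; exists (u * v).
    by apply: MM => //; exact: Md.
  by rewrite algM ea eb [d%:A ^+ i.+2]exprS; ring.
have Jcl : integrally_closed_ideal J.
  split=> //; apply/seteqP; split; last exact: sub_integral_closure.
  move=> x [n [p [Jp e]]].
  have [di dd] := fraction_inv frac dreg.
  have [w ew] : exists w, d%:A * w = x%:A :> Q.
    by exists (x%:A * di); rewrite mulrCA dd mulr1.
  have /choice[m mP] : forall i, exists w, (1 <= i <= n)%N ->
      M w /\ (p i)%:A = d%:A ^+ i * w.
    move=> [|i]; first by exists 0.
    have [/Jp/Jpow[v Mv ev]|] := boolP (1 <= i.+1 <= n)%N; last by exists 0.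
    by exists v.
  (* The equation of [x] over [J], divided by [d^n], has coefficients in [M]; so [w = x/d] is
     integral, [w^n] is in [M], and [w] is in [M]. *)
  have weq : w ^+ n + \sum_(1 <= i < n.+1) m i * w ^+ (n - i) = 0.
    apply: (@unit_cancel _ _ (d%:A ^+ n)).
      by exists (di ^+ n); rewrite -exprMn dd expr1n.
    rewrite -[RHS](alg0 Q) -e algD algX alg_sum mulrDr -exprMn ew; congr (_ + _).
    rewrite mulr_sumr !big_nat; apply: eq_bigr => i /andP[i1]; rewrite ltnS => ni.
    have [|_ ep] := mP i; first by rewrite i1.
    rewrite algM ep algX -ew exprMn.
    by rewrite -[in LHS](subnKC ni) addKn exprD; ring.
  have iw : integral w.
    apply: (@integral_of_eq _ _ w n (fun i => - m (n - i)%N)).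
      move=> i ni; apply: integralN.
      have [|/Md[]//] := mP (n - i)%N; by rewrite subn_gt0 ni leq_subr.
    move/eqP: weq; rewrite addr_eq0 => /eqP ->; rewrite -sumrN big_add1 big_mkord.
    rewrite (reindex_inj rev_ord_inj) /=; apply: eq_bigr => i _.
    by rewrite subnSK// mulNr subKn// ltnW.
  have dw : overring d w by split=> //; exists x.
  exists w => //; apply: (Mprime _ n) => //.
  move/eqP: weq; rewrite addr_eq0 => /eqP ->; rewrite -mulN1r mulrC.
  apply: (MM); last by apply: overringN; exact: overring1.
  rewrite big_nat; apply: (big_ind M) => // i /mP[Mm _].
  by apply: MM => //; exact: overringX.
have [_ [a0 ea0]] := dc.
have [c' ec'] := cunit; have [di dd] := fraction_inv frac dreg.
have a0inv : a0%:A * (c' * di) = 1 :> Q by rewrite -ea0 [c' * _]mulrC mulrACA dd ec' mulr1.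
have Ja0 : J a0 by exists c.
have [|a [n [[y My ea] Jn]]] := reductions Jcl.
  by exists a0 => //; exact: alg_lreg a0inv.
have Jn_ideal := ideal_pow_ideal J n.
have a0n k : exists v, (a0 ^+ k)%:A * v = 1 :> Q.
  by exists ((c' * di) ^+ k); rewrite algX -exprMn a0inv expr1n.
have [z ez] : exists z, a * z = a0 ^+ n.+1.
  have : ideal_pow J n.+1 (a0 ^+ n.+1) by exact: ideal_powX.
  by rewrite Jn => -[z _ <-]; exists z.
have [v ev] := a0n n.+1.
have eav : a%:A * (z%:A * v) = 1 :> Q by rewrite mulrA -algM ez.
have yunit : y * (d%:A * (z%:A * v)) = 1 by rewrite mulrCA mulrA -ea.
(* For [j = d w], the fraction [j/a] maps [J^n] into itself, as [j J^n] lies in [J^(n+1) = a J^n].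
   Thus [a0^n] clears the denominators of all its powers, and it is integral. *)
have MyB w : M w -> in_ideal y w.
  move=> Mw; have [_ [j ej]] := Md _ Mw; have Jj : J j by exists w.
  exists (j%:A * (z%:A * v)); last first.
    by rewrite -ej -[LHS]mul1r -[in LHS]yunit; ring.
  apply: (integral_of_bounded noeth frac (d := a0 ^+ n)).
    by have [? /alg_lreg] := a0n n; apply.
  move=> k; suff [x _ ex] : exists2 x, ideal_pow J n x &
      (a0 ^+ n)%:A * (j%:A * (z%:A * v)) ^+ k = x%:A by exists x.
  elim: k => [|k [x Jx ex]].
    by exists (a0 ^+ n); [exact: ideal_powX|rewrite mulr1].
  have : ideal_pow J n.+1 (j * x) by exact: ideal_mulP.
  rewrite Jn => -[x' Jx' e]; exists x' => //.
  rewrite exprSr mulrA ex mulrA -algM mulrC [x * j]mulrC -e algM.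
  by rewrite mulrA [_ * a%:A]mulrC eav mul1r.
exists a, y; split.
- exact: alg_lreg eav.
- split=> //; first exact: Md.
  move=> r dr; have [Mr|[r' dr' Mr]] := Mmax _ dr; [left|right].
    exact: MyB.
  by exists r' => //; exact: MyB.
- exact: MyB.
(* An integral inverse of [y] is a polynomial in [y], so it lies in [overring d] and [1] would be in
   [M]. *)
- move=> [b ib e]; apply: nM1.
  have [l [r er]] := inv_integral (esym e) ib.
  rewrite e; apply: MM => //; rewrite er; apply: overring_sum => i _.
  by apply: overringM => //; [exact: overring_alg|apply: overringX => //; exact: Md].
Qed.

End Link.
End Overrings.

(** * Combinations of linear relations *)

Section Combinations.
Variables (A : comNzRingType) (Q : comAlgType A).

(** The [C]-span of [rel]; the number of terms is an index because the descent eliminates them one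
    by one. *)
Inductive comb (T : Type) (C : set Q) (rel : set (T -> Q)) :
    nat -> (T -> Q) -> Prop :=
| Comb0 e : (forall j, e j = 0) -> comb C rel 0 e
| CombS k p a e e' : C p -> rel a -> comb C rel k e ->
    (forall j, e' j = p * a j + e j) -> comb C rel k.+1 e'.

Lemma comb_map (T T' : Type) (C : set Q) (rel : set (T -> Q))
    (rel' : set (T' -> Q)) (phi : (T -> Q) -> T' -> Q) k e :
  (forall a, rel a -> rel' (phi a)) -> (forall j, phi (fun=> 0) j = 0) ->
  (forall p a b j, phi (fun i => p * a i + b i) j = p * phi a j + phi b j) ->
  comb C rel k e -> comb C rel' k (phi e).
Proof.
move=> relphi phi0 phiD; elim=> [f f0|l p a f f' Cp ra _ IH ef].
  by apply: Comb0 => j; have -> : f = fun=> 0 by apply/funext.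
apply: (CombS Cp (relphi _ ra) IH) => j.
by rewrite -phiD; congr (phi _ _); apply/funext.
Qed.

Lemma comb_sub (T : Type) (C : set Q) (rel rel' : set (T -> Q)) k e :
  rel `<=` rel' -> comb C rel k e -> comb C rel' k e.
Proof. by move=> rr; apply: (comb_map (phi := id)). Qed.

Lemma combD (T : Type) (C : set Q) (rel : set (T -> Q)) k l e f :
  comb C rel k e -> comb C rel l f -> comb C rel (k + l) (fun j => e j + f j).
Proof.
move=> + cf; elim=> [g g0|m p a g g' Cp ra _ IH eg].
  by have -> : (fun j => g j + f j) = f by apply/funext => j; rewrite g0 add0r.
by apply: (CombS Cp ra IH) => j; rewrite eg addrA.
Qed.

Lemma combN (T : Type) (C : set Q) (rel : set (T -> Q)) k e :
  (forall p, C p -> C (- p)) ->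
  comb C rel k e -> comb C rel k (fun j => - e j).
Proof.
move=> CN; elim=> [g g0|m p a g g' Cp ra _ IH eg].
  by apply: Comb0 => j; rewrite g0 oppr0.
by apply: (CombS (CN _ Cp) ra IH) => j; rewrite eg opprD mulNr.
Qed.

Lemma comb1 (T : Type) (C : set Q) (rel : set (T -> Q)) p a :
  C p -> rel a -> comb C rel 1 (fun j => p * a j).
Proof.
move=> Cp ra; apply: (CombS Cp ra (e := fun=> 0)); first exact: Comb0.
by move=> j; rewrite addr0.
Qed.

(** The finitely many coefficients have a common denominator [c]. *)
Lemma comb_denominator (T : Type) (rel : set (T -> Q)) k e : fraction_ring Q ->
  comb (@integral A Q) rel k e -> exists2 c : A, GRing.lreg c &
  forall C : set Q, (forall w, integral w ->
    (exists a, c%:A * w = a%:A) -> C w) -> comb C rel k e.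
Proof.
move=> frac; elim=> [f f0|l p a f f' ip ra _ [c creg IH] ef].
  by exists 1; [exact: lreg1|move=> C _; exact: Comb0].
have [d [b [dreg eb]]] := fraction_denom frac p.
exists (c * d) => [|C CP]; first exact: lregM.
apply: (CombS _ ra _ ef).
  by apply: CP => //; exists (c * b); rewrite !algM -eb mulrA.
apply: IH => w iw [z ez]; apply: CP => //.
by exists (d * z); rewrite !algM -ez mulrAC mulrC mulrA.
Qed.

Definition relation (R : set Q) n (q : nat -> Q) : set (nat -> Q) :=
  [set a : nat -> Q | (forall j : nat, R (a j)) /\ \sum_(j < n) a j * q j = 0].

Definition pair_tuple (x z : Q) (q : nat -> Q) j :=
  match j with 0%N => x | 1%N => z | j'.+2 => q j' end.

End Combinations.

(** * Descent of strict closure elements along links *)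

Section Descent.
Variables (A : comNzRingType) (Q : comAlgType A).
Hypotheses (frac : fraction_ring Q) (dprod : divided_products Q).
Implicit Types (d : A) (u v w x y : Q) (q : nat -> Q).

Section OneLink.
Variables (d d1 : A) (y : Q) (C : set Q).
Hypotheses (dreg : GRing.lreg d) (d1reg : GRing.lreg d1)
  (link : maximal_link d d1 y).
Hypotheses (CD : forall u v, C u -> C v -> C (u + v))
  (CM : forall u v, C u -> C v -> C (u * v)) (C1 : C (- 1))
  (d1C : overring d1 `<=` C).

Let yreg : injective ( *%R y).
Proof.
apply: unit_inj; have [v e] := fraction_inv frac d1reg.
have [_ ed _] := link; exists (d%:A * v).
by rewrite mulrCA mulrA -ed.
Qed.

Let overring_link w : overring d w -> overring d1 w.
Proof.
move=> dw; have [dy ed _] := link.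
have [_ [a ea]] := overringM dprod dreg dy dw.
by split; [by case: dw|exists a; rewrite ed -mulrA].
Qed.

(** With [overring_mul_link], this identifies the trace of [yB] on [overring d] with [y R_{d1}]. *)
Let in_ideal_div w : overring d w -> in_ideal y w ->
  exists2 b, overring d1 b & w = y * b.
Proof.
move=> [_ [a ea]] [b ib e]; exists b => //; split=> //; exists a.
by have [_ -> _] := link; rewrite -mulrA -e.
Qed.

Let overring_mul_link b : overring d1 b -> overring d (y * b).
Proof.
move=> [ib [a ea]]; have [[iy _] ed _] := link; split; first exact: integralM.
by exists a; rewrite mulrA -ed.
Qed.

Let dC w : overring d w -> C w. Proof. by move/overring_link/d1C. Qed.
Let CB u v : C u -> C v -> C (u - v).
Proof. by move=> Cu Cv; rewrite -mulN1r; exact: CD Cu (CM C1 Cv). Qed.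

Lemma relation_div n q a : relation (overring d) n q a ->
  (forall j, in_ideal y (a j)) ->
  exists2 b, relation (overring d1) n q b & forall j, a j = y * b j.
Proof.
move=> [da asum] ya.
have /choice[b bP] j : exists b, overring d1 b /\ a j = y * b.
  by have [b db e] := in_ideal_div (da j) (ya j); exists b.
exists b => [|j]; last by have [] := bP j.
split=> [j|]; first by have [] := bP j.
apply: yreg; rewrite /= mulr0 -[RHS]asum mulr_sumr; apply: eq_bigr => j _.
by rewrite mulrA; have [_ <-] := bP j.
Qed.

(** Subtracting multiples of the relation [a] is linear and preserves relations. If [r] inverts
    [a j0] modulo [y], it clears coordinate [j0] modulo [y]. *)
Lemma comb_pivot n q a r j0 k t : relation (overring d) n q a -> overring d r ->
  comb C (relation (overring d) n q) k t ->
  comb C (relation (overring d) n q) k (fun j => t j - r * t j0 * a j).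
Proof.
move=> [da asum] dr; apply: (comb_map (phi := fun t j => t j - r * t j0 * a j)).
- move=> b [db bsum]; split=> [j|].
    by apply: overringB => //; do 2 apply: overringM => //.
  under eq_bigr do rewrite mulrBl -[_ * a _ * _]mulrA.
  by rewrite sumrB -mulr_sumr asum bsum mulr0 subr0.
- by move=> j; rewrite !(mulr0, mul0r) subr0.
- by move=> p b c j; ring.
Qed.

(* Division by [y] in the relation module, the heart of the descent: a
   coefficient outside the maximal ideal [yB] of [overring d] is used as a pivot
   to eliminate one term, and a row inside that ideal can be divided by [y]. *)
Lemma comb_div n q k e : (forall j, C (e j)) ->
  comb C (relation (overring d) n q) k (fun j => y * e j) ->
  exists l, comb C (relation (overring d1) n q) l e.
Proof.
elim: k e => [|k IH] e Ce cye.
  exists 0%N; apply: Comb0 => j; inversion cye as [f f0|]; subst.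
  by apply: yreg; rewrite /= f0 mulr0.
inversion cye as [|k' p a t f Cp ra ct ef]; subst; clear cye.
have [da asum] := ra.
have [ya|] := pselect (forall j, in_ideal y (a j)).
  have [b rb eb] := relation_div ra ya.
  have [||l cl] := IH (fun j => e j - p * b j).
  - by move=> j; apply/CB/CM => //; apply: d1C; case: rb.
  - have -> // : (fun j => y * (e j - p * b j)) = t.
    by apply/funext => j; rewrite mulrBr ef eb; ring.
  exists l.+1; apply: (CombS Cp rb cl) => j; ring.
move=> /existsNP[j0 naj]; have [_ _ /(_ _ (da j0))[//|[r dr]]] := link.
have d1r : overring d (1 - a j0 * r).
  by apply: overringB; [exact: overring1|exact: overringM].
move=> /(in_ideal_div d1r)[m dm em].
(* As [1 - a j0 * r = y * m], pivoting the remaining terms gives exactly [y (e - g a)]. *)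
pose g := m * p + r * e j0.
have Cg : C g.
  by apply: CD; apply: CM => //; [exact: d1C|exact: dC].
have [||l cl] := IH (fun j => e j - g * a j).
- by move=> j; apply/CB/CM => //; exact: dC.
- suff -> : (fun j => y * (e j - g * a j)) = fun j => t j - r * t j0 * a j.
    exact: comb_pivot.
  apply/funext => j.
  have tE i : t i = y * e i - p * a i by rewrite ef; ring.
  rewrite !tE /g; apply/eqP; rewrite -subr_eq0; apply/eqP.
  by transitivity ((1 - a j0 * r - y * m) * (p * a j)); [ring|rewrite em subrr mul0r].
exists l.+1; apply: (CombS (a := a) Cg _ cl) => [|j]; last by ring.
by split=> // j; exact: overring_link.
Qed.

(** Linear algebra over the residue field of the link: if all coordinates but the first of a
    combination of rows come from the field, so does the first. Indeed a row vanishing in the other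
    coordinates modulo [y] vanishes altogether, because the tuple starts with [1]. *)
Lemma comb_residue n q k e a t : (forall j, integral (q j)) ->
  (forall j, overring d (e j.+1)) ->
  relation (overring d) n.+1 (fun j => if j is j'.+1 then q j' else 1) a ->
  comb C (relation (overring d) n.+1 (fun j => if j is j'.+1 then q j' else 1))
    k t ->
  (forall j, exists2 c, C c & e j = a j + t j + y * c) ->
  exists r c, [/\ overring d r, C c & e 0%N = r + y * c].
Proof.
move=> iq de; elim: k a t => [|k IH] a t ra ct et.
  have [c Cc ec] := et 0%N; exists (a 0%N), c; split=> //.
    by case: ra.
  by inversion ct as [f f0|]; subst; rewrite ec f0 addr0.
inversion ct as [|k' p b s f Cp rb cs ef]; subst; clear ct.
have [db bsum] := rb; have [da asum] := ra.
have [[iy _] _ _] := link.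
have [yb|] := pselect (forall j, in_ideal y (b j.+1)).
  apply: (IH a s) => // j; have [c Cc ->] := et j; rewrite ef.
  suff [b' db' ->] : exists2 b', overring d1 b' & b j = y * b'.
    exists (p * b' + c); last ring.
    by apply: CD => //; apply: CM => //; exact: d1C.
  apply: in_ideal_div; first exact: db.
  case: j => // {Cc c}.
  have /choice[c cP] j : exists c, integral c /\ b j.+1 = y * c.
    by have [c ic e'] := yb j; exists c.
  exists (- \sum_(j < n) c j * q j).
    apply: integralN; apply: integral_sum => j _; apply: integralM => //.
    by have [] := cP j.
  move/eqP: bsum; rewrite big_ord_recl /= mulr1 addr_eq0 => /eqP ->.
  rewrite mulrN mulr_sumr; congr (- _); apply: eq_bigr => j _.
  by rewrite /bump /= add1n; have [_ ->] := cP j; rewrite mulrA.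
move=> /existsNP[j0 nbj]; have [_ _ /(_ _ (db j0.+1))[//|[r dr]]] := link.
have d1r : overring d (1 - b j0.+1 * r).
  by apply: overringB; [exact: overring1|exact: overringM].
move=> /(in_ideal_div d1r)[m dm em].
have drea : overring d (r * (e j0.+1 - a j0.+1)).
  by apply: overringM => //; exact: overringB.
(* Modulo [yC] the coefficient [p] is [r (e - a - s)] at [j0.+1]. The part with [e - a] has values
   in [overring d] and joins [a]; the part with [s] pivots the remaining rows. *)
apply: (IH (fun j => a j + r * (e j0.+1 - a j0.+1) * b j) _ _ (comb_pivot j0.+1 rb dr cs)).
- split=> [j|]; first by apply: overringD => //; exact: overringM.
  under eq_bigr do rewrite mulrDl -[_ * b _ * _]mulrA.
  by rewrite big_split -mulr_sumr /= asum bsum mulr0 addr0.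
- move=> j; have [c Cc ec] := et j; have [c0 Cc0 ec0] := et j0.+1.
  exists (c + m * (p * b j) - r * c0 * b j).
    apply: CB; last exact: CM (CM (dC dr) Cc0) (dC (db j)).
    by apply: CD => //; apply: CM; [exact: d1C|apply: CM => //; exact: dC].
  rewrite ec ec0 !ef; apply/eqP; rewrite -subr_eq0; apply/eqP.
  transitivity ((1 - b j0.+1 * r - y * m) * (p * b j)); first ring.
  by rewrite em subrr mul0r.
Qed.

Lemma descent_link n q x : (forall j, integral (q j)) -> C x ->
  (exists k, comb C (relation (overring d) n.+2 (pair_tuple 1 x q)) k
    (pair_tuple x (- 1) (fun=> 0))) -> integral x ->
  (forall b, C b -> (exists k, comb C (relation (overring d1) n.+2
      (pair_tuple 1 b q)) k (pair_tuple b (- 1) (fun=> 0))) -> overring d1 b) ->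
  overring d x.
Proof.
move=> iq Cx [k cx] ix IH.
have qE : pair_tuple 1 x q =
    fun j => if j is j'.+1 then (if j' is j''.+1 then q j'' else x) else 1.
  by apply/funext => -[|[|j]].
have d0 : overring d (0 : Q) by rewrite -(alg0 Q); exact: overring_alg.
have [] := @comb_residue n.+1 (fun j => if j is j'.+1 then q j' else x) k
  (pair_tuple x (- 1) (fun=> 0)) (fun=> 0) (pair_tuple x (- 1) (fun=> 0)).
- by case.
- by move=> [|j] //=; apply: overringN; exact: overring1.
- by split=> //; rewrite big1// => j _; rewrite mul0r.
- by rewrite qE in cx.
- move=> j; exists 0; last by rewrite add0r mulr0 addr0.
  exact: dC.
move=> r [b [dr Cb /= ex]].
suff /IH -/(_ Cb) db : exists k, comb C (relation (overring d1) n.+2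
      (pair_tuple 1 b q)) k (pair_tuple b (- 1) (fun=> 0)).
  by rewrite ex; apply: overringD => //; exact: overring_mul_link.
apply: (@comb_div n.+2 (pair_tuple 1 b q) k).
  by move=> [|[|j]] //=; exact: dC.
(* Substituting [x = r + y b] turns relations among [(1, x, q)] into relations among [(1, b, q)],
   and the vector [(x, -1, 0, ...)] into [y (b, -1, 0, ...)], which [comb_div] divides by [y]. *)
pose phi (a : nat -> Q) := pair_tuple (a 0%N + r * a 1%N) (y * a 1%N)
  (fun j => a j.+2).
have -> : (fun j => y * pair_tuple b (- 1) (fun=> 0) j) =
    phi (pair_tuple x (- 1) (fun=> 0)).
  by apply/funext => -[|[|j]]; rewrite /phi /= ?ex; ring.
apply: comb_map cx.
- move=> a [da asum]; split=> [[|[|j]]|].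
  + by apply: overringD => //; exact: overringM.
  + by apply: overringM => //; case: link.
  + exact: da.
  + move: asum; rewrite !big_ord_recl /= => asum.
    by rewrite -[RHS]asum ex; ring.
- by move=> [|[|j]] //=; ring.
- by move=> p a b' [|[|j]] //=; ring.
Qed.

End OneLink.

Inductive reach (d : A) : A -> Prop :=
| Reach0 : reach d d
| ReachS d1 y d2 : GRing.lreg d1 -> maximal_link d d1 y -> reach d1 d2 ->
    reach d d2.

Lemma reach_step d d' d1 y : reach d d' -> GRing.lreg d1 ->
  maximal_link d' d1 y -> reach d d1.
Proof.
move=> + d1reg; elim=> [e link'|e e1 y' e2 ereg link' _ IH link1].
  exact: ReachS d1reg link' (Reach0 _).
exact: ReachS ereg link' (IH link1).
Qed.

Lemma reach_sub d d' : GRing.lreg d -> reach d d' ->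
  @overring A Q d `<=` overring d'.
Proof.
move=> + r; elim: r => [e _ //|e e1 y e2 e1reg [ey ed _] _ IH ereg w ew].
apply: IH => //; have [_ [a ea]] := overringM dprod ereg ey ew.
by split; [by case: ew|exists a; rewrite ed -mulrA].
Qed.

Lemma descent d d' n q x : reach d d' -> GRing.lreg d -> GRing.lreg d' ->
  (forall j, integral (q j)) -> overring d' x ->
  (exists k, comb (overring d') (relation (overring d) n.+2 (pair_tuple 1 x q)) k
    (pair_tuple x (- 1) (fun=> 0))) -> overring d x.
Proof.
move=> r; elim: r x => [//|e e1 y e2 e1reg link r IH] x ereg e2reg iq Cx cx.
apply: (descent_link ereg e1reg link _ _ _ _ iq Cx cx).
- by move=> u v; exact: overringD.
- by move=> u v; exact: overringM.
- by apply: overringN; exact: overring1.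
- exact: reach_sub.
- by case: Cx.
- by move=> b Cb cb; exact: IH.
Qed.

End Descent.

(** * Chains of links reaching a given denominator *)

Section Chain.
Variables (A : comNzRingType) (Q : comAlgType A).
Hypotheses (noeth : noetherian A) (frac : fraction_ring Q)
  (dprod : divided_products Q).
Hypothesis reductions : forall I : set A, integrally_closed_ideal I ->
  (exists2 x, I x & GRing.lreg x) -> has_principal_reduction I.
Hypothesis dim1 : forall (P : set A) x,
  GRing.lreg x -> prime_ideal P -> P x -> maximal_ideal P.

(** Among the reachable [d] with [c] in [dB], take one with minimal trace of [dB] on [A]. If [c/d]
    is not invertible in [overring d], one more link through it gives a strictly smaller trace, as
    [1] is not in [yB]. *)
Lemma reach_overring (c : A) : GRing.lreg c -> exists d, [/\ GRing.lreg d,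
  reach Q 1 d & forall w : Q, integral w -> (exists a, c%:A * w = a%:A) ->
    overring d w].
Proof.
move=> creg.
pose Jd d := [set a : A | in_ideal (d%:A : Q) a%:A].
have [||_ [[d [dreg rd -> [c' ic' ec']]] dmin]] :=
    ideals_dcc noeth (fun P => @dim1 P c creg)
    (F := fun J => exists d, [/\ GRing.lreg d, reach Q 1 d, J = Jd d & J c]).
- move=> _ [d [dreg rd -> Jc]]; split=> //; split.
  + by exists 0; rewrite ?mulr0 ?alg0//; rewrite -(alg0 Q); exact: integral_alg.
  + move=> a b [u iu ea] [v iv eb]; exists (u + v); first exact: integralD.
    by rewrite algD ea eb mulrDr.
  + move=> a b [v iv eb]; exists (a%:A * v).
      by apply: integralM => //; exact: integral_alg.
    by rewrite algM eb mulrCA.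
- exists (Jd 1), 1; split=> //; [exact: lreg1|exact: Reach0|].
  by exists c%:A; [exact: integral_alg|rewrite alg1 mul1r].
exists d; split=> // w iw [a ea].
have dc' : overring d c' by split=> //; exists c.
have [[u du cu]|cninv] := pselect (exists2 u, overring d u & c' * u = 1).
  have -> : w = c' * w * u by rewrite mulrAC cu mul1r.
  apply: overringM => //; split; first exact: integralM.
  by exists a; rewrite mulrA -ec'.
have [v ev] := fraction_inv frac creg.
have cunit : exists v', c' * v' = 1.
  by exists (d%:A * v); rewrite mulrCA mulrA -ec'.
have [d1 [y [d1reg link [b ib eb] ny1]]] :=
  exists_maximal_link noeth frac dprod dreg dc' cunit cninv reductions.
have [[iy _] ed _] := link.
case: ny1; have [] : Jd d1 d.
- apply: (dmin (Jd d1)).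
  + exists d1; split=> //; first exact: reach_step rd d1reg link.
    by exists b => //; rewrite ec' eb ed mulrA.
  + move=> a' [b' ib' e]; exists (y * b'); first exact: integralM.
    by rewrite e ed mulrA.
  + by exists 1; rewrite ?mulr1// -(alg1 Q); exact: integral_alg.
move=> b' ib' e; exists b' => //.
by apply: (unit_inj (fraction_inv frac dreg)); rewrite /= mulr1 mulrA -ed.
Qed.

Lemma comb_overring1 n (q : nat -> Q) x : (forall j, integral (q j)) ->
  integral x ->
  (exists k, comb (@integral A Q) (relation (overring 1) n.+2
    (pair_tuple 1 x q)) k (pair_tuple x (- 1) (fun=> 0))) ->
  exists a, x = a%:A.
Proof.
move=> iq ix [k cx]; have [c creg cC] := comb_denominator frac cx.
have [d0 [b [d0reg eb]]] := fraction_denom frac x.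
(* [c] takes care of the coefficients of the combination and [d0] of [x]; the descent then ends in
   [overring 1], which is [A]. *)
have [d [dreg rd dP]] := reach_overring (lregM creg d0reg).
have : overring 1 x.
  apply: (descent frac dprod rd) => //; first exact: lreg1.
    by apply: dP => //; exists (c * b); rewrite !algM -eb mulrA.
  exists k; apply: cC => w iw [a ea]; apply: dP => //.
  by exists (d0 * a); rewrite !algM -ea mulrAC mulrC mulrA.
by move=> [_ [a]]; rewrite alg1 mul1r; exists a.
Qed.

End Chain.

Section TotalFractionRing.
Variable A : comNzRingType.
Local Notation Q := (total_frac A).
Local Notation S := (nonzerodivisors A).

Lemma total_frac_alg (a : A) : a%:A = loc_frac a (multset1 S) :> Q.
Proof. exact: mulr1. Qed.

Lemma tfracE (y x : A) (xreg : GRing.lreg x) :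
  x%:A * tfrac y xreg = y%:A :> Q.
Proof.
rewrite !total_frac_alg loc_fracM; apply/loc_frac_eq; exists 1.
  exact: multset1.
ring.
Qed.

Lemma total_frac_fraction_ring : fraction_ring Q.
Proof.
split.
- move=> a b /=; rewrite !total_frac_alg => /loc_frac_eq[u ureg].
  by rewrite !mulr1 -[RHS](mulr0 u) => /ureg/eqP; rewrite subr_eq0 => /eqP.
- by move=> d dreg; exists (tfrac 1 dreg); rewrite tfracE alg1.
- move=> w; have [a [d [dreg ->]]] := loc_fracP w.
  by exists d, a; split=> //; exact: tfracE.
Qed.

Lemma tfrac_unique (y x : A) (xreg : GRing.lreg x) (u : Q) :
  x%:A * u = y%:A -> u = tfrac y xreg.
Proof.
move=> e; have [v xv] := fraction_inv total_frac_fraction_ring xreg.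
by apply: (unit_inj (ex_intro _ v xv)); rewrite e tfracE.
Qed.

End TotalFractionRing.

(** * From tensor equalities to combinations of relations *)

Section TensorRelations.
Variables (A : comNzRingType) (Q : comAlgType A).
Local Notation B := (integral_closure Q).
Local Notation fr x y := (<< (x, y) >> : {freeg (B * B)%type / int}).

Definition fiber_coef (z : B) (p : B * B) : zmodule Q := ic_val p.1 * (p.2 == z)%:R.

(** The coordinate at [z] of the image of [u] in the free [B]-module on the set [B], where [(x, z)]
    goes to [x] times the basis vector of [z]. *)
Definition fiber_sum (u : {freeg (B * B)%type / int}) (z : B) : Q :=
  fglift (fiber_coef z) u.

Lemma fiber_sumB u v z : fiber_sum (u - v) z = fiber_sum u z - fiber_sum v z.
Proof. exact: (@lift_is_additive int _ (zmodule Q) (fiber_coef z) u v). Qed.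

Lemma fiber_sum0 z : fiber_sum 0 z = 0.
Proof. by rewrite -[0 in LHS](subrr 0) fiber_sumB subrr. Qed.

Lemma fiber_sumD u v z : fiber_sum (u + v) z = fiber_sum u z + fiber_sum v z.
Proof. by rewrite -[v in LHS]opprK -(sub0r v) !fiber_sumB fiber_sum0 sub0r opprK. Qed.

Lemma fiber_sumU x y z : fiber_sum (fr x y) z = ic_val x * (y == z)%:R.
Proof. by rewrite /fiber_sum liftU scale1r. Qed.

Definition list_relation (L : seq B) : set (B -> Q) :=
  [set a : B -> Q | [/\ forall z : B, exists c : A, a z = c%:A,
     forall z, z \notin L -> a z = 0 &
     \sum_(z <- undup L) a z * ic_val z = 0]].

Lemma sum_undup_sub (L L' : seq B) (F : B -> Q) : {subset L <= L'} ->
  (forall z, z \notin L -> F z = 0) ->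
  \sum_(z <- undup L') F z = \sum_(z <- undup L) F z.
Proof.
move=> LL' F0; rewrite (bigID (mem L)) /= [X in _ + X]big1 ?addr0//.
rewrite -big_filter; apply: perm_big; apply: uniq_perm.
- exact/filter_uniq/undup_uniq.
- exact: undup_uniq.
- move=> z; rewrite mem_filter !mem_undup.
  by case: (boolP (z \in L)) => // /LL' ->.
Qed.

Lemma list_relation_sub (L L' : seq B) : {subset L <= L'} ->
  list_relation L `<=` list_relation L'.
Proof.
move=> LL' a [aA a0 asum]; split=> // [z|].
  by move=> zL'; apply: a0; apply: contra zL'; exact: LL'.
by rewrite (sum_undup_sub LL')// => z /a0 ->; rewrite mul0r.
Qed.

Lemma sum_undup_delta (L : seq B) (w : B) : w \in L ->
  \sum_(z <- undup L) (w == z)%:R * ic_val z = ic_val w.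
Proof.
move=> wL; rewrite (@sum_undup_sub [:: w])//= ?big_seq1 ?eqxx ?mul1r//.
  by move=> z; rewrite inE => /eqP ->.
by move=> z; rewrite inE eq_sym => /negPf ->; rewrite mul0r.
Qed.

Lemma delta_notin (L : seq B) (w z : B) : w \in L -> z \notin L -> (w == z) = false.
Proof. by move=> wL; apply: contraNF => /eqP <-. Qed.

(** Left additivity holds already in the free [B]-module; right additivity and the exchange of
    scalars are [B]-multiples of [A]-linear relations between finitely many elements of [B]. *)
Lemma tensor_rel_comb (u : {freeg (B * B)%type / int}) : tensor_rel u ->
  exists L k, comb (@integral A Q) (list_relation L) k (fiber_sum u).
Proof.
elim=> {u}.
- by exists [::], 0%N; apply: Comb0 => z; exact: fiber_sum0.
- move=> u v _ [L [k cu]] _ [L' [k' cv]]; exists (L ++ L'), (k + k')%N.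
  have -> : fiber_sum (u - v) = fun z => fiber_sum u z + - fiber_sum v z.
    by apply/funext => z; exact: fiber_sumB.
  apply: combD; last apply: combN; first last.
  + apply: comb_sub cv; apply: list_relation_sub => z zL.
    by rewrite mem_cat zL orbT.
  + exact: integralN.
  + apply: comb_sub cu; apply: list_relation_sub => z zL.
    by rewrite mem_cat zL.
- move=> x x' y; exists [::], 0%N; apply: Comb0 => z.
  by rewrite fiber_sumB fiber_sumD !fiber_sumU -mulrDl subrr.
- move=> x y y'; exists [:: y + y'; y; y'], 1%N.
  have -> : fiber_sum (fr x (y + y') - (fr x y + fr x y')) = fun z =>
      ic_val x * ((y + y' == z)%:R - ((y == z)%:R + (y' == z)%:R)).
    by apply/funext => z; rewrite fiber_sumB fiber_sumD !fiber_sumU; ring.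
  apply: comb1; first exact: asboolW (valP x).
  split.
  + move=> z; exists ((y + y' == z)%:R - ((y == z)%:R + (y' == z)%:R)).
    by rewrite algD algN algD -![(_%:R)%:A]/(in_alg Q _) !rmorph_nat.
  + by move=> z zL; rewrite !(delta_notin _ zL) ?inE ?eqxx ?orbT// addr0 subrr.
  + under eq_bigr do rewrite mulrBl mulrDl.
    rewrite sumrB big_split !sum_undup_delta ?inE ?eqxx ?orbT//.
    exact: subrr.
- move=> a x y; exists [:: y; a *: y], 1%N.
  have -> : fiber_sum (fr (a *: x) y - fr x (a *: y)) = fun z =>
      ic_val x * (a%:A * (y == z)%:R - (a *: y == z)%:R).
    apply/funext => z; rewrite fiber_sumB !fiber_sumU.
    have -> : ic_val (a *: x) = a%:A * ic_val x by rewrite mulr_algl; exact: GRing.valZ.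
    ring.
  apply: comb1; first exact: asboolW (valP x).
  split.
  + move=> z; exists (a * (y == z)%:R - (a *: y == z)%:R).
    by rewrite algD algN algM -![(_%:R)%:A]/(in_alg Q _) !rmorph_nat.
  + by move=> z zL; rewrite !(delta_notin _ zL) ?inE ?eqxx ?orbT// mulr0 subrr.
  + under eq_bigr do rewrite mulrBl -mulrA.
    rewrite sumrB -mulr_sumr !sum_undup_delta ?inE ?eqxx ?orbT//.
    by rewrite mulr_algl -[ic_val (a *: y)]/(val (a *: y)) GRing.valZ subrr.
Qed.

Lemma strict_closure_comb (x : B) : strict_closure x -> x != 1 ->
  exists n (q : nat -> Q) k, (forall j, integral (q j)) /\
    comb (@integral A Q) (relation (@overring A Q 1) n.+2 (pair_tuple 1 (ic_val x) q)) k
      (pair_tuple (ic_val x) (- 1) (fun=> 0)).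
Proof.
move=> + xn1; rewrite /strict_closure /= /pure_tensor => /eqmodP/=.
rewrite /Quotient.equiv /= => /asboolP/tensor_rel_comb[L [k cL]].
(* [1 :: x :: K] then lists the elements of [L] without repetition, with [1] and [x] in the first
   two places. *)
pose K := undup [seq z <- L | (z != 1) && (z != x)].
exists (size K), (fun j => ic_val (nth 0 K j)), k; split.
  by move=> j; exact: (asboolW (valP K`_j)).
pose K' := 1 :: x :: K.
have uK' : uniq K'.
  rewrite /K' /= undup_uniq inE !mem_undup !mem_filter !eqxx /= andbF eq_sym.
  by rewrite (negPf xn1).
have LK' : {subset L <= K'}.
  move=> z zL; rewrite !inE mem_undup mem_filter zL andbT.
  by case: eqP => //=; case: eqP.
have := comb_sub (list_relation_sub LK') cL.
pose phi (a : B -> Q) j := if (j < size K')%N then a (nth 0 K' j) else 0.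
have -> : pair_tuple (ic_val x) (- 1) (fun=> 0) = phi (fiber_sum (fr x 1 - fr 1 x)).
  apply/funext => j; rewrite /phi fiber_sumB !fiber_sumU.
  case: j => [|[|j]] /=.
  - by rewrite eqxx (negPf xn1) mulr1 mulr0 subr0.
  - by rewrite eqxx eq_sym (negPf xn1) mulr1 mulr0 sub0r.
  - rewrite !ltnS; case: ifP => // jK; have := mem_nth 0 jK.
    rewrite mem_undup mem_filter => /andP[/andP[]].
    by rewrite ![nth _ _ _ == _]eq_sym => /negPf -> /negPf -> _; rewrite !mulr0 subrr.
apply: comb_map.
- move=> a [aA a0 asum]; split.
  + move=> j; rewrite /phi; case: ifP => _; last first.
      by rewrite -(alg0 Q); exact: overring_alg.
    by have [c ->] := aA (nth 0 K' j); exact: overring_alg.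
  + rewrite -[RHS]asum (undup_id uK') [RHS](big_nth 0) big_mkord.
    apply: eq_bigr => j _; rewrite /phi ltn_ord; congr (_ * _).
    by case: (nat_of_ord j) => [|[|i]].
- by move=> j; rewrite /phi; case: ifP.
- by move=> p a b j; rewrite /phi; case: ifP => // _; rewrite mulr0 addr0.
Qed.

End TensorRelations.

Lemma arf_strictly_closed (A : comNzRingType) : semi_local_one_dim_cm A ->
  arf_ring A -> strictly_closed_in (integral_closure (total_frac A)).
Proof.
move=> hA [_ reductions dprod]; have [noeth _ _] := hA.
apply/seteqP; split=> [x xstrict|_ [a _ <-]]; last first.
  rewrite /strict_closure /= /pure_tensor; apply/eqmodP/asboolP => /=.
  exact: TensorRelZ.
(* The tuple [(1, x, ...)] needs distinct first entries. *)
have [->|xn1] := eqVneq x 1; first by exists 1 => //; exact: scale1r.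
have [n [q [k [iq cx]]]] := strict_closure_comb xstrict xn1.
have [] := @comb_overring1 A (total_frac A) noeth (total_frac_fraction_ring A)
  _ reductions _ n q (ic_val x) iq _ _.
- move=> u y z v w ureg ey ez iv iw.
  have [||a e] := dprod u y z ureg.
  - by move: iv; rewrite {1}(tfrac_unique ureg ey).
  - by move: iw; rewrite {1}(tfrac_unique ureg ez).
  exists a; rewrite -e; apply: tfrac_unique.
  by rewrite mulrA mulrA -mulrA mulrACA ey ez algM.
- by move=> P u ureg Ppr Pu; exact: prime_regular_maximal hA ureg Ppr Pu.
- exact: asboolW (valP x).
- by exists k.
move=> a e; exists a => //; apply: val_inj; rewrite /= e; reflexivity.
Qed.

(** * Strictly closed rings are Arf *)

Section Nakayama.
Variables (Q : comNzRingType) (aa S : set Q).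
Hypotheses (aa0 : aa 0) (aaB : forall a b, aa a -> aa b -> aa (a - b))
  (aaM : forall a b, aa a -> aa b -> aa (a * b)).
Hypotheses (S0 : S 0) (SB : forall v w, S v -> S w -> S (v - w))
  (SM : forall a v, aa a -> S v -> S (a * v)).

Let aaD a b : aa a -> aa b -> aa (a + b).
Proof. by move=> ha hb; rewrite -[b]opprK -(sub0r b); do 2 apply: aaB => //. Qed.

Let SD v w : S v -> S w -> S (v + w).
Proof. by move=> hv hw; rewrite -[w]opprK -(sub0r w); do 2 apply: SB => //. Qed.

(** Instead of a determinant, the last vector is eliminated. The coefficients form a ring without
    unit, which covers both a maximal ideal of [A] and values of Rees polynomials. *)
Lemma nakayama m (v : nat -> Q) :
  (forall i, (i < m)%N -> exists2 c : nat -> Q,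
     forall j, aa (c j) & S (v i - \sum_(j < m) c j * v j)) ->
  exists2 a, aa a & forall i, (i < m)%N -> S ((1 - a) * v i).
Proof.
elim: m => [|m IH] hv; first by exists 0.
have [c ac Sc] := hv m (ltnSn m).
rewrite big_ord_recr /= in Sc.
have [i im|a aaa Sa] := IH.
  have [b ab Sb] := hv i (leqW im); rewrite big_ord_recr /= in Sb.
  (* The congruence of [v i] is multiplied by [1 - c m], and [(1 - c m) v m] is replaced by the sum
     of the [c j * v j] with [j < m]. *)
  exists (fun j => (b j - c m * b j + b m * c j) + (if j == i then c m else 0)).
    move=> j; apply: aaD; last by case: eqP.
    by apply: aaD; [apply: aaB => //|]; apply: aaM.
  under eq_bigr do rewrite mulrDl.
  have delta : \sum_(j < m) (if j == i :> nat then c m else 0) * v j = c m * v i.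
    rewrite (bigD1 (Ordinal im)) //= eqxx big1 ?addr0// => j ji.
    by rewrite ifN ?mul0r//; apply: contra ji => /eqP ji; apply/eqP/val_inj.
  rewrite big_split /= delta.
  have -> : \sum_(j < m) (b j - c m * b j + b m * c j) * v j =
        (1 - c m) * (\sum_(j < m) b j * v j) + b m * (\sum_(j < m) c j * v j).
      by rewrite !mulr_sumr -big_split /=; apply: eq_bigr => j _; ring.
  move: (\sum_(j < m) b j * v j) (\sum_(j < m) c j * v j) Sb Sc => sb sc Sb Sc.
  have -> : v i - ((1 - c m) * sb + b m * sc + c m * v i) =
      (v i - (sb + b m * v m)) - c m * (v i - (sb + b m * v m))
      + b m * (v m - (sc + c m * v m)) by ring.
  by apply: SD; [apply: SB => //|]; exact: SM.
(* [1] minus this element is [(1 - a)(1 - c m)]. *)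
exists (a + c m - a * c m) => [|i].
  by apply: aaB; [exact: aaD|exact: aaM].
rewrite ltnS leq_eqVlt => /orP[/eqP->|im].
  have -> : (1 - (a + c m - a * c m)) * v m =
      (v m - (\sum_(j < m) c j * v j + c m * v m))
      - a * (v m - (\sum_(j < m) c j * v j + c m * v m))
      + \sum_(j < m) c j * ((1 - a) * v j).
    under [X in _ = _ + X]eq_bigr do rewrite mulrCA.
    rewrite -mulr_sumr; ring.
  apply: SD; first by apply: SB => //; exact: SM.
  by apply: (big_ind S) => // j _; apply: SM => //; exact: Sa.
have -> : (1 - (a + c m - a * c m)) * v i =
   (1 - a) * v i - c m * ((1 - a) * v i) by ring.
by apply: SB; [exact: Sa|apply: SM => //; exact: Sa].
Qed.

End Nakayama.

Section PureTensors.
Variables (A : comNzRingType) (M N : lmodType A).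

Lemma pure_tensorDl (x x' : M) (y : N) :
  pure_tensor (x + x') y = pure_tensor x y + pure_tensor x' y.
Proof.
rewrite /pure_tensor -[RHS]raddfD.
by apply/eqmodP/asboolP; exact: TensorRelDl.
Qed.

Lemma pure_tensorDr (x : M) (y y' : N) :
  pure_tensor x (y + y') = pure_tensor x y + pure_tensor x y'.
Proof.
rewrite /pure_tensor -[RHS]raddfD.
by apply/eqmodP/asboolP; exact: TensorRelDr.
Qed.

Lemma pure_tensorZ a (x : M) (y : N) :
  pure_tensor (a *: x) y = pure_tensor x (a *: y).
Proof. by apply/eqmodP/asboolP; exact: TensorRelZ. Qed.

Lemma pure_tensor_suml n (F : 'I_n -> M) (y : N) :
  pure_tensor (\sum_i F i) y = \sum_i pure_tensor (F i) y.
Proof.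
apply: (big_morph (fun x => pure_tensor x y)) => [x x'|].
  exact: pure_tensorDl.
by apply: (addrI (pure_tensor 0 y)); rewrite -pure_tensorDl !addr0.
Qed.

Lemma pure_tensor_sumr n (x : M) (F : 'I_n -> N) :
  pure_tensor x (\sum_i F i) = \sum_i pure_tensor x (F i).
Proof.
apply: (big_morph (pure_tensor x)) => [y y'|].
  exact: pure_tensorDr.
by apply: (addrI (pure_tensor x 0)); rewrite -pure_tensorDr !addr0.
Qed.

End PureTensors.

(** * Elements of the strict closure *)

Section StrictClosureForms.
Variables (A : comNzRingType) (B : comAlgType A).
Implicit Types (x y z a c : A) (u v : B).

(** Scalars cross the tensor sign: [xuv (x) 1 = v (x) xu = xv (x) u = 1 (x) zu]. *)
Lemma strict_closure_div x y z u v :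
  x *: u = y%:A -> x *: v = z%:A -> strict_closure (x *: (u * v)).
Proof.
move=> eu ev; rewrite /strict_closure /= scalerAl eu mulr_algl pure_tensorZ.
rewrite -eu -pure_tensorZ ev pure_tensorZ; congr pure_tensor.
by rewrite -[LHS]mulr_algl -[RHS]mulr_algl -ev -eu -!scalerAl mulrC.
Qed.

Lemma shift_sym (T : Type) d (f : nat -> nat -> T) :
  (forall i j, (i < d)%N -> (j < d)%N -> f i.+1 j = f i j.+1) ->
  forall i j, (i <= d)%N -> (j <= d)%N -> f i j = f j i.
Proof.
move=> fS.
have fl l i j : (i + l <= d)%N -> (j + l <= d)%N -> f (i + l)%N j = f i (j + l)%N.
  elim: l j => [|l IH] j; first by rewrite !addn0.
  rewrite !addnS => il jl; rewrite fS ?IH ?addSn//; first exact: ltnW.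
  exact: leq_ltn_trans (leq_addr l j) jl.
move=> i j; wlog ij : i j / (i <= j)%N.
  by move=> H id jd; case/orP: (leq_total i j) => /H ->.
by move=> _ jd; rewrite -(subnKC ij) -fl ?subnKC.
Qed.

Variables (d : nat) (x z : A) (g : nat -> A) (p : nat -> B).
Hypotheses (xp : forall i, (i < d)%N -> x *: p i.+1 = z *: p i)
  (gp : \sum_(i < d.+1) g i *: p i = 1).

(* [p i] stands for [x^(d-i) z^i / F(x,z)] where [F] is the form with
   coefficients [g]; by [xp] the tensor [x p_i (x) p_j] only depends on [i + j]. *)
Lemma strict_closure_form c i : c = x \/ c = z -> (i <= d)%N ->
  strict_closure (c *: p i).
Proof.
move=> cxz id.
have psym a k l : (k <= d)%N -> (l <= d)%N ->
    pure_tensor ((a * c) *: p k) (p l) = pure_tensor ((a * c) *: p l) (p k).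
  apply: (@shift_sym _ d (fun k l => pure_tensor ((a * c) *: p k) (p l))).
  have xpa m : (m < d)%N -> (a * x) *: p m.+1 = (a * z) *: p m.
    by move=> md; rewrite -!scalerA xp.
  move=> {}k {}l kd ld; case: cxz => ->.
  - by rewrite xpa// pure_tensorZ -xpa// -pure_tensorZ.
  - by rewrite pure_tensorZ -(xpa l ld) -pure_tensorZ xpa.
(* Expanding [1] by [gp] on both sides leaves the symmetry of [g j * c] times [p i (x) p j]. *)
rewrite /strict_closure /= -[X in pure_tensor _ X = _]gp.
rewrite -[X in _ = pure_tensor X _]gp pure_tensor_sumr pure_tensor_suml; apply: eq_bigr => j _.
rewrite -pure_tensorZ !scalerA psym//; last by rewrite -ltnS.
by rewrite -pure_tensorZ scalerA mulrC.
Qed.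

End StrictClosureForms.

(** * Prescribing membership in finitely many maximal ideals *)

Section SemiLocal.
Variable A : comNzRingType.

Lemma maximal_sub (M N : set A) : maximal_ideal M -> maximal_ideal N ->
  M `<=` N -> M = N.
Proof. by move=> [_ _ Mmax] [Nid N1 _] MN; rewrite (Mmax N). Qed.

Lemma avoid_maximals n (M : nat -> set A) (N : set A) :
  (forall i, (i < n)%N -> maximal_ideal (M i)) -> maximal_ideal N ->
  (forall i, (i < n)%N -> M i <> N) ->
  exists2 p, forall i, (i < n)%N -> M i p & ~ N p.
Proof.
move=> Mmax Nmax; have [_ N1 NM] := maximal_prime Nmax.
elim: n Mmax => [|n IH] Mmax MN; first by exists 1.
have [i im|i im|p Mp Np] := IH; [exact: Mmax (leqW im)|exact: MN (leqW im)|].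
have [q Mq Nq] : exists2 q, M n q & ~ N q.
  apply: contrapT => noq; apply: (MN n (ltnSn n)); apply: maximal_sub => //.
    exact: Mmax.
  by move=> q Mq; apply: contrapT => Nq; apply: noq; exists q.
exists (p * q); last by case/NM.
move=> i; rewrite ltnS leq_eqVlt => /orP[/eqP->|im].
  by apply: idealMl => //; case: (Mmax n (ltnSn n)).
by apply: idealMr; [case: (Mmax i (leqW im))|exact: Mp].
Qed.

(** A Chinese remainder argument: [e] is corrected at a new ideal by a multiple of some [p] that
    lies in the earlier ideals but not in the new one. *)
Lemma maximal_complement n (M : nat -> set A) x :
  (forall i, (i < n)%N -> maximal_ideal (M i)) ->
  exists e, forall i, (i < n)%N -> M i e <-> ~ M i x.
Proof.
elim: n => [|n IH] Mmax; first by exists 1.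
have [i im|e eP] := IH; first exact: Mmax (leqW im).
have Nmax := Mmax n (ltnSn n); have [Nid N1 Nmx] := Nmax.
have [[i im MN]|diff] := pselect (exists2 i, (i < n)%N & M i = M n).
  exists e => j; rewrite ltnS leq_eqVlt => /orP[/eqP->|/eP//].
  by rewrite -MN; exact: eP.
have [|i im MN|p Mp Np] := @avoid_maximals n M (M n) _ Nmax.
- by move=> i im; exact: Mmax (leqW im).
- by apply: diff; exists i.
suff [r rP] : exists r, M n (e + r * p) <-> ~ M n x.
  exists (e + r * p) => j; rewrite ltnS leq_eqVlt => /orP[/eqP->//|jn].
  have [Mid _ _] := Mmax j (leqW jn); rewrite -eP//; split=> [h|h].
    by rewrite -(addrK (r * p) e); apply: idealB => //; apply: idealMl => //; exact: Mp.
  by apply: idealD => //; apply: idealMl => //; exact: Mp.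
have [Nx|nNx] := pselect (M n x); have [Ne|nNe] := pselect (M n e).
- exists 1; split=> // h; exfalso; apply: Np.
  by have -> : p = e + 1 * p - e; [ring|exact: idealB].
- by exists 0; rewrite mul0r addr0; split=> [/nNe|/(_ Nx)].
- by exists 0; rewrite mul0r addr0; split.
- have [s Ns] := maximal_inv Nmax Np; exists (- e * s); split=> // _.
  by have -> : e + - e * s * p = e * (1 - s * p); [ring|exact: idealMl].
Qed.

Lemma semi_local_complement x : semi_local A ->
  exists e, forall M : set A, maximal_ideal M -> M e <-> ~ M x.
Proof.
move=> /finite_setP[n]; rewrite card_eq_sym => /card_set_bijP[f fbij].
have [fM _ fsurj] := fbij.
have [i im|e eP] := @maximal_complement n f x; first exact: fM.
by exists e => M /fsurj[i im <-]; exact: eP.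
Qed.

End SemiLocal.

(** * Polynomials in [t = z/x] and the denominators [g_d] *)

Section Forms.
Variables (A : comNzRingType) (Q : comAlgType A).
Hypotheses (noeth : noetherian A) (frac : fraction_ring Q).
Variables (x z : A) (t : Q).
Hypotheses (xreg : GRing.lreg x) (xt : x%:A * t = z%:A).
Local Notation ev := (horner_alg t).

Lemma ev_sum (p : {poly A}) n : (size p <= n)%N ->
  ev p = \sum_(i < n) (p`_i)%:A * t ^+ i.
Proof.
move=> pn; rewrite {1}(_ : p = \sum_(i < n) p`_i *: 'X^i).
  rewrite raddf_sum; apply: eq_bigr => i _ /=.
  by rewrite linearZ rmorphXn /= horner_algX mulr_algl.
rewrite -poly_def; apply/polyP => i; rewrite coef_poly.
by case: ltnP => // ni; rewrite nth_default// (leq_trans pn).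
Qed.

Lemma evZ a (p : {poly A}) : ev (a *: p) = a%:A * ev p.
Proof. by rewrite linearZ /= mulr_algl. Qed.

Lemma ev_bounded (p : {poly A}) n : (size p <= n.+1)%N ->
  exists a, x%:A ^+ n * ev p = a%:A.
Proof.
move=> pn; exists (\sum_(i < n.+1) p`_i * (x ^+ (n - i) * z ^+ i)).
rewrite (ev_sum pn) alg_sum mulr_sumr; apply: eq_bigr => -[i /=].
rewrite ltnS => ni _; rewrite !algM !algX -xt exprMn.
by rewrite -[in LHS](subnK ni) exprD; ring.
Qed.

Hypothesis dim1 : forall P : set A, prime_ideal P -> P x -> maximal_ideal P.

(* Krull-Akizuki: the ideals [x^k A[t] /\ A + xA] of [A] stabilize, hence
   [A[t]/xA[t]] is a finite [A]-module. *)
Lemma krull_akizuki : exists f c : {poly A}, f \is monic /\ ev f = x%:A * ev c.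
Proof.
have [x' xx'] := fraction_inv frac xreg.
have xK : injective ( *%R (x%:A : Q)) by apply: unit_inj; exists x'.
pose J k := [set a : A | exists p r, a%:A = x%:A ^+ k * ev p + (x * r)%:A].
have JS k l : (k <= l)%N -> J l `<=` J k.
  move=> kl a [p [r e]]; exists (x ^+ (l - k) *: p), r.
  by rewrite evZ algX mulrA -exprD subnKC.
have [||_ [[n ->] Jmin]] := ideals_dcc noeth dim1 (F := fun I => exists k, I = J k).
- move=> _ [k ->]; split; last by exists 0, 1; rewrite rmorph0 mulr0 add0r mulr1.
  split.
  + by exists 0, 0; rewrite rmorph0 !mulr0 alg0 addr0.
  + move=> a b [p [r ea]] [q [s eb]]; exists (p + q), (r + s).
    by rewrite algD ea eb rmorphD /= !algM algD; ring.
  + move=> b a [p [r ea]]; exists (b *: p), (b * r).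
    by rewrite algM ea evZ !algM; ring.
- by exists (J 0%N), 0%N.
have Jn l : (n <= l)%N -> J l `<=` J l.+1.
  move=> nl; apply: subset_trans (JS _ _ nl) _; apply: Jmin; first by exists l.+1.
  exact: JS (leqW nl).
have xA p l : (n <= l)%N ->
    exists a q, x%:A ^+ l * ev p = a%:A + x%:A ^+ l.+1 * ev q.
  move=> nl; pose L := (size p + l)%N.
  have lL : (l <= L)%N by exact: leq_addl.
  have base : exists a q, x%:A ^+ L * ev p = a%:A + x%:A ^+ L.+1 * ev q.
    have [|a ea] := @ev_bounded p (size p); first exact: leqnSn.
    exists (x ^+ l * a), 0; rewrite rmorph0 mulr0 addr0 algM algX -ea /L exprD.
    by rewrite mulrA; congr (_ * _); rewrite mulrC.
  (* By stability [a] lies in [J m.+2], so it is a multiple of [x] in [A] up to [x^(m+2) A[t]], and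
     one factor [x] cancels. *)
  have desc m : (l <= m)%N ->
      (exists a q, x%:A ^+ m.+1 * ev p = a%:A + x%:A ^+ m.+2 * ev q) ->
      exists a q, x%:A ^+ m * ev p = a%:A + x%:A ^+ m.+1 * ev q.
    move=> lm [a [q e]].
    have : J m.+1 a.
      exists (p - x *: q), 0; rewrite mulr0 alg0 addr0 rmorphB /= evZ.
      by rewrite mulrBr e [_ ^+ m.+2]exprSr mulrA addrK.
    move/(Jn _ (leq_trans nl (leqW lm))) => [p' [r er]]; exists r, (p' + q).
    apply: xK; rewrite /= mulrA -exprS e er rmorphD /= algM !exprS; ring.
  move: (L - l)%N (subnK lL) base => k <-; elim: k => [//|k IH].
  by rewrite addSn => /desc/IH; apply; exact: leq_addl.
have /choice[a /choice[c acP]] : forall m, exists a, exists c,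
    x%:A ^+ n * t ^+ m = a%:A + x%:A ^+ n.+1 * ev c.
  move=> m; have [a [q e]] := xA 'X^m n (leqnn n); exists a, q.
  by rewrite -e rmorphXn /= horner_algX.
(* A relation among the constants [a i] makes [x^n (t^N - ...)] a multiple of [x^(n+1)]. *)
have [N [r er]] := noetherian_seq a noeth.
exists ('X^N - \poly_(i < N) r i), (c N - \sum_(i < N) r i *: c i); split.
  rewrite monicE lead_coefDl ?lead_coefXn// size_polyN size_polyXn ltnS.
  exact: size_poly.
have xnK : injective ( *%R (x%:A ^+ n : Q)).
  by apply: unit_inj; exists (x' ^+ n); rewrite -exprMn xx' expr1n.
apply: xnK; rewrite /= rmorphB /= rmorphXn /= horner_algX poly_def raddf_sum /=.
rewrite mulrBr acP er alg_sum rmorphB /= raddf_sum /= !mulrA -exprSr [RHS]mulrBr.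
suff -> : x%:A ^+ n * (\sum_(i < N) ev (r i *: 'X^i)) =
    \sum_(i < N) (r i * a i)%:A + x%:A ^+ n.+1 * \sum_(i < N) ev (r i *: c i).
  ring.
rewrite !mulr_sumr -big_split /=; apply: eq_bigr => i _.
by rewrite !evZ rmorphXn /= horner_algX mulrCA acP algM; ring.
Qed.

Section Denominator.
Variables (f c : {poly A}) (e : A) (N D d n : nat).
Hypotheses (fmon : f \is monic) (fN : size f = N.+1) (fc : ev f = x%:A * ev c)
  (cD : (size c <= D.+1)%N) (ND : (N <= D)%N) (Nd : (N < d)%N)
  (dn : (2 * d + D <= n)%N).
Hypothesis eP : forall M : set A, maximal_ideal M -> M e <-> ~ M x.

(** At a maximal ideal containing [x], the value is [1] modulo [x] while the leading coefficient [e]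
    is a unit; at the others, [e] vanishes and the polynomial is [1]. *)
Definition denominator_poly : {poly A} := 1 + e *: ('X^(d - N) * f).
Local Notation g := denominator_poly.

Lemma size_denominator : (size g <= d.+1)%N.
Proof.
apply: leq_trans (size_polyD _ _) _; rewrite size_poly1 geq_max ltnS leq0n /=.
apply: leq_trans (size_scale_leq _ _) _; apply: leq_trans (size_polyMleq _ _) _.
by rewrite size_polyXn fN addSn /= addnS subnK// ltnW.
Qed.

(** [g(t) W_(n-d)], with [W_k] the polynomials in [t] of degree at most [k]. *)
Let S : set Q := [set w | exists2 q : {poly A},
  (size q <= (n - d).+1)%N & w = ev g * ev q].

Let SB v w : S v -> S w -> S (v - w).
Proof.
move=> [p sp ->] [q sq ->]; exists (p - q); last by rewrite rmorphB mulrBr.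
by apply: leq_trans (size_polyD _ _) _; rewrite size_polyN geq_max sp.
Qed.

Let S0 : S 0.
Proof. by exists 0; rewrite ?size_poly0// rmorph0 mulr0. Qed.

Let SZ a v : S v -> S (a%:A * v).
Proof.
move=> [p sp ->]; exists (a *: p); last by rewrite evZ; ring.
exact: leq_trans (size_scale_leq _ _) sp.
Qed.

Section AtMaximal.
Variable M : set A.
Hypothesis Mmax : maximal_ideal M.

Let Mid : is_ideal M. Proof. by case: Mmax. Qed.

(** [S + M W_n]; Nakayama's lemma needs [t^j] in [T] for all [j <= n]. *)
Let T : set Q := [set w | exists2 p : {poly A},
  (size p <= n.+1)%N /\ (forall i, M p`_i) & S (w - ev p)].

Let TB v w : T v -> T w -> T (v - w).
Proof.
move=> [p [sp Mp] Sp] [q [sq Mq] Sq]; exists (p - q).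
  split; last by move=> i; rewrite coefB; exact: idealB.
  by apply: leq_trans (size_polyD _ _) _; rewrite size_polyN geq_max sp.
have -> : v - w - ev (p - q) = (v - ev p) - (w - ev q) by rewrite rmorphB /=; ring.
exact: SB.
Qed.

Let ST v : S v -> T v.
Proof.
move=> Sv; exists 0; last by rewrite rmorph0 subr0.
by split=> [|i]; rewrite ?size_poly0// coef0; exact: ideal0.
Qed.

Let T0 : T 0. Proof. exact: ST. Qed.

Let TD v w : T v -> T w -> T (v + w).
Proof.
by move=> Tv Tw; rewrite -[w]opprK -(sub0r w); apply: TB => //; exact: TB.
Qed.

Let TZ a v : T v -> T (a%:A * v).
Proof.
move=> [p [sp Mp] Sp]; exists (a *: p).
  split; last by move=> i; rewrite coefZ; exact: idealMl.
  exact: leq_trans (size_scale_leq _ _) sp.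
by rewrite evZ -mulrBr; exact: SZ.
Qed.

Let Tev m (p : {poly A}) : M m -> (size p <= n.+1)%N -> T (m%:A * ev p).
Proof.
move=> Mm sp; exists (m *: p); last by rewrite evZ subrr.
split; last by move=> i; rewrite coefZ; exact: idealMr.
exact: leq_trans (size_scale_leq _ _) sp.
Qed.

Let Xle j : (j <= n)%N -> (size ('X^j : {poly A}) <= n.+1)%N.
Proof. by rewrite size_polyXn ltnS. Qed.

Let evX j : ev 'X^j = t ^+ j. Proof. by rewrite rmorphXn /= horner_algX. Qed.

Let evg j : ev g * t ^+ j = t ^+ j + e%:A * (t ^+ (d - N + j) * ev f).
Proof. by rewrite rmorphD rmorph1 /= evZ rmorphM /= evX exprD; ring. Qed.

Let Tin j : M x -> (j <= n)%N -> T (t ^+ j).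
Proof.
move=> Mx; have /(maximal_inv Mmax)[s Ms] : ~ M e by rewrite eP.
have Nd' := ltnW Nd.
elim/ltn_ind: j => j IH jn.
(* For small [j], [g t^j - t^j] is [x] times an element of [W_n]. For large [j], the leading term of
   [g t^(j-d)] expresses [e t^j] by lower powers, and [e] is invertible modulo [M]. *)
have [jsmall|jbig] := leqP (d - N + j + D) n.
  have -> : t ^+ j = ev g * t ^+ j - e%:A * (x%:A * ev ('X^(d - N + j) * c)).
    by rewrite evg fc rmorphM /= evX; ring.
  apply: TB; [apply: ST|apply: TZ; apply: Tev => //].
    exists 'X^j; rewrite ?evX// size_polyXn; lia.
  apply: leq_trans (size_polyMleq _ _) _; rewrite size_polyXn addSn /=.
  by move: cD jsmall; move: (size c) => sc; lia.
have dj : (d <= j)%N by move: dn jbig Nd; lia.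
have Te : T (e%:A * t ^+ j).
  have -> : e%:A * t ^+ j = ev g * t ^+ (j - d) - t ^+ (j - d)
      - e%:A * \sum_(i < N) (f`_i)%:A * t ^+ (j - N + i).
    rewrite evg [X in X - _ - _]addrC addrK -mulrBr; congr (_ * _).
    have -> : (d - N + (j - d) = j - N)%N by move: Nd dj; lia.
    rewrite (@ev_sum f N.+1) ?fN// big_ord_recr /=.
    have -> : f`_N = 1 by have := monicP fmon; rewrite lead_coefE fN.
    rewrite alg1 mul1r mulrDr -exprD subnK ?(leq_trans Nd')// mulr_sumr.
    rewrite [X in X - _]addrC -[LHS]addr0 -addrA; congr (_ + _).
    apply/esym/eqP; rewrite subr_eq0; apply/eqP; apply: eq_bigr => i _.
    by rewrite exprD; ring.
  apply: TB; first apply: TB.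
  - apply: ST; exists 'X^(j - d); rewrite ?evX// size_polyXn ltnS.
    exact: leq_sub2r.
  - by apply: IH; move: Nd dj jn; lia.
  - apply: TZ; apply: (big_ind T) => // i _; apply: TZ.
    by apply: IH; move: (ltn_ord i) Nd dj jn; lia.
have -> : t ^+ j = s%:A * (e%:A * t ^+ j) + (1 - s * e)%:A * ev 'X^j.
  by rewrite evX algD algN algM alg1; ring.
by apply: TD; [exact: TZ|apply: Tev => //; exact: Xle].
Qed.

Let Tnotin j : ~ M x -> (j <= n)%N -> T (t ^+ j).
Proof.
move=> nMx jn; have Me : M e by apply/eP.
have [r Mr] := maximal_inv Mmax nMx.
(* As [x^n t^j] is in [A], this puts [t^j] in [A + M W_n]; and [1 = g(t) - e t^(d-N) f(t)] is in [T]
   because [e] is in [M]. *)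
have [m [Mm em]] : exists m, M m /\ (r * x) ^+ n = 1 - m.
  exists (1 - (r * x) ^+ n); split; last by ring.
  rewrite -{1}(expr1n A n) subrXX; exact: idealMr.
have [|a ea] := @ev_bounded 'X^j n; first exact: Xle.
have -> : t ^+ j = (r ^+ n * a)%:A * 1 + m%:A * ev 'X^j.
  rewrite mulr1 algM -ea mulrA -algX -algM -exprMn em evX algD algN alg1; ring.
have Nd' := ltnW Nd.
have dn' : (d <= n)%N by move: dn; lia.
apply: TD; [apply: TZ|apply: Tev => //; exact: Xle].
have -> : 1 = ev g * ev 1 - e%:A * ev ('X^(d - N) * f).
  by rewrite rmorph1 rmorphD rmorph1 /= evZ; ring.
apply: TB; first by apply: ST; exists 1; rewrite ?size_poly1.
apply: Tev => //; apply: leq_trans (size_polyMleq _ _) _.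
by rewrite size_polyXn fN addSn /= addnS subnK.
Qed.

Lemma denominator_at_maximal : exists2 s, ~ M s &
  forall j, (j <= n)%N -> S (s%:A * t ^+ j).
Proof.
have M1 : ~ M 1 by case: Mmax.
have [|||||i|a [m Mm <-] Sa] := @nakayama Q [set a%:A | a in M] S _ _ _ _ SB _
    n.+1 (fun j => t ^+ j).
- by exists 0; [exact: ideal0|exact: alg0].
- move=> _ _ [a Ma <-] [b Mb <-]; exists (a - b); first exact: idealB.
  by rewrite algD algN.
- move=> _ _ [a Ma <-] [b Mb <-]; exists (a * b); first exact: idealMl.
  by rewrite algM.
- exact: S0.
- by move=> _ v [a Ma <-]; exact: SZ.
- rewrite ltnS => jn.
  have [p [sp Mp] Sp] : T (t ^+ i).
    by have [Mx|nMx] := pselect (M x); [exact: Tin|exact: Tnotin].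
  exists (fun j => (p`_j)%:A); first by move=> j; exists p`_j.
  by rewrite -(ev_sum sp).
- exists (1 - m) => [M1m|j jn].
    by apply: M1; rewrite -(subrK m 1); exact: idealD.
  by rewrite algD algN alg1; exact: Sa.
Qed.

End AtMaximal.

(** The [s] with [s W_n] inside [g W_(n-d)] form an ideal contained in no maximal ideal. *)
Lemma denominator_mul (p : {poly A}) : (size p <= n.+1)%N ->
  exists2 q : {poly A}, (size q <= (n - d).+1)%N & ev p = ev g * ev q.
Proof.
move=> sp.
pose I := [set s : A | forall j, (j <= n)%N -> S (s%:A * t ^+ j)].
have SD v w : S v -> S w -> S (v + w).
  by move=> Sv Sw; rewrite -[w]opprK -(sub0r w); do 2 apply: SB => //.
have I1 : I 1.
  apply: not_sub_maximal1 => //.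
    split.
    - by move=> j _; rewrite alg0 mul0r; exact: S0.
    - by move=> a b Ia Ib j jn; rewrite algD mulrDl; apply: SD; [exact: Ia|exact: Ib].
    - by move=> a b Ib j jn; rewrite algM -mulrA; apply: SZ; exact: Ib.
  by move=> M /denominator_at_maximal[s Ms Is]; exists s.
suff : S (ev p) by [].
rewrite (ev_sum sp); apply: (big_ind S) => // i _.
by apply: SZ; rewrite -[X in S X]mul1r -(alg1 Q); apply: I1; rewrite -ltnS.
Qed.

End Denominator.
End Forms.

(** * Principal reductions *)

Section Reductions.
Variables (A : comNzRingType) (Q : comAlgType A).
Hypotheses (noeth : noetherian A) (frac : fraction_ring Q).

(** The ideal [N] witnesses that [y] generates a reduction of [(x, z)]: it satisfies
    [xN + zN = yN]. *)
Lemma two_generator_reduction (x z e : A) : GRing.lreg x ->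
  (forall P : set A, prime_ideal P -> P x -> maximal_ideal P) ->
  (forall M : set A, maximal_ideal M -> M e <-> ~ M x) ->
  (forall b : integral_closure Q, strict_closure b ->
    exists a, ic_val b = a%:A) ->
  exists y (N : set A), [/\ GRing.lreg y, is_ideal N,
    exists2 r, N r & GRing.lreg r,
    forall u a, u = x \/ u = z -> N a -> exists2 b, N b & u * a = y * b &
    forall a, N a -> exists b c, [/\ N b, N c & y * a = x * b + z * c]].
Proof.
move=> xreg dim1 eP strict.
have [x' xx'] := fraction_inv frac xreg.
pose t : Q := z%:A * x'.
have xt : x%:A * t = z%:A by rewrite /t mulrCA xx' mulr1.
clearbody t.
have [f [c [fmon fc]]] := krull_akizuki noeth frac xreg xt dim1.
have [m fm] : exists m, size f = m.+1.
  have := monic_neq0 fmon; rewrite -size_poly_gt0.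
  by case: (size f) => // m _; exists m.
(* [n] is large enough for both denominators [g_d] and [g_(d+1)]. *)
pose D := (m + size c)%N; pose d := m.+1; pose n := (2 * d.+1 + D)%N.
have cD : (size c <= D.+1)%N by rewrite leqW// leq_addl.
have mD : (m <= D)%N by exact: leq_addr.
have md : (m < d)%N by [].
have md1 : (m < d.+1)%N by exact: leqW.
have dn : (2 * d + D <= n)%N by rewrite leq_add2r leq_mul2l leqnSn.
have H0 := denominator_mul noeth xt fmon fm fc cD mD md dn eP.
have H1 := denominator_mul noeth xt fmon fm fc cD mD md1 (leqnn n) eP.
have s0 := size_denominator e fm md; have s1 := size_denominator e fm md1.
move: (denominator_poly f e m d) (denominator_poly f e m d.+1) H0 H1 s0 s1.
move=> g0 g1 H0 H1 s0 s1.
have [|q0 sq0] := H0 1; first by rewrite size_poly1.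
rewrite rmorph1; move: (horner_alg t q0) => gi /esym g0i.
have xnA (p : {poly A}) k : (size p <= k.+1)%N -> exists a, x%:A ^+ k * horner_alg t p = a%:A.
  exact: (ev_bounded xt).
(* Multiplication by [t^i / g0] maps [W_(n-d)] into itself, so [x^(n-d)] clears the denominators of
   all its powers. *)
have Pint i : (i <= d)%N -> integral (t ^+ i * gi).
  move=> id; apply: (integral_of_bounded noeth frac (lregX (n := n - d) xreg)) => k.
  suff [q sq ->] : exists2 q : {poly A}, (size q <= (n - d).+1)%N &
      (t ^+ i * gi) ^+ k = horner_alg t q by rewrite algX; exact: xnA.
  elim: k => [|k [q sq eq]]; first by exists 1; rewrite ?size_poly1// rmorph1.
  have [|q' sq' eq'] := H0 ('X^i * q).
    apply: leq_trans (size_polyMleq _ _) _; rewrite size_polyXn addSn /=.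
    apply: leq_trans (leq_add id sq) _; rewrite addnS subnKC//.
    by rewrite /n; lia.
  exists q' => //; rewrite exprS eq.
  move: eq'; rewrite rmorphM rmorphXn /= horner_algX => eq'.
  by rewrite mulrAC eq' mulrAC g0i mul1r.
have /choice[P PE] : forall i, exists b : integral_closure Q,
    (i <= d)%N -> ic_val b = t ^+ i * gi.
  move=> i; have [/Pint ii|] := leqP i d; last by exists 0.
  by exists (IntegralClosure (asboolT ii)).
have xP i : (i < d)%N -> x *: P i.+1 = z *: P i.
  move=> id; apply: val_inj; rewrite !GRing.valZ /= !PE//; last exact: ltnW.
  by rewrite -[LHS]mulr_algl -[RHS]mulr_algl -xt exprS; ring.
have gP : \sum_(i < d.+1) g0`_i *: P i = 1.
  apply: val_inj; rewrite raddf_sum /= -[RHS]g0i (ev_sum t s0) mulr_suml.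
  by apply: eq_bigr => i _; rewrite -mulrA -PE -1?ltnS// mulr_algl.
have PA u i : u = x \/ u = z -> (i <= d)%N ->
    exists a, u%:A * (t ^+ i * gi) = a%:A.
  move=> uxz id.
  have [a ea] := strict _ (strict_closure_form xP gP uxz id).
  by exists a; rewrite -ea -PE// mulr_algl.
(* Expanding [g1], the constant term uses [x p_0], and the others use [x t^(i+1) / g0 = z p_i]. *)
have [y ey] : exists y, x%:A * horner_alg t g1 * gi = y%:A.
  have [a0 ea0] := PA x 0%N (or_introl erefl) isT.
  have /choice[b bP] : forall i, exists b, (i <= d)%N ->
      z%:A * (t ^+ i * gi) = b%:A.
    move=> i; have [id|] := leqP i d; last by exists 0.
    by have [b eb] := PA z i (or_intror erefl) id; exists b.
  exists (g1`_0 * a0 + \sum_(i < d.+1) g1`_i.+1 * b i).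
  rewrite (ev_sum t s1) big_ord_recl /= algD algM -ea0 alg_sum.
  rewrite mulrDr mulrDl; congr (_ + _); first ring.
  rewrite mulr_sumr mulr_suml; apply: eq_bigr => i _.
  by rewrite algM -bP -1?ltnS// /bump /= add1n -xt exprS; ring.
have [|q1 _] := H1 1; first by rewrite size_poly1.
rewrite rmorph1; move: (horner_alg t q1) => g1i /esym g1i1.
have yinv : y%:A * (horner_alg t g0 * g1i * x') = 1.
  rewrite -ey; transitivity ((x%:A * x') * (horner_alg t g0 * gi) * (horner_alg t g1 * g1i)); first ring.
  by rewrite xx' g0i g1i1 !mulr1.
have yreg := alg_lreg frac yinv.
(* Both [g0 W_(k+1)] and [g1 W_k] are [W_n]; as [y = x g1 / g0], this gives [x W_(k+1) = y W_k]. *)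
pose k := (n - d.+1)%N.
have kd : (k.+1 = n - d)%N by rewrite /k subnSK// /n; lia.
have xy (p : {poly A}) : (size p <= k.+2)%N -> exists2 q : {poly A}, (size q <= k.+1)%N &
    x%:A * horner_alg t p = y%:A * horner_alg t q.
  move=> sp; have [|q sq eq] := H1 (g0 * p).
    apply: leq_trans (size_polyMleq _ _) _.
    have : (size g0 + size p <= d.+1 + k.+2)%N by exact: leq_add.
    by move: (size g0 + size p)%N; rewrite kd /n; lia.
  exists q => //; rewrite -ey; move: eq; rewrite rmorphM /= => eq.
  transitivity (x%:A * horner_alg t p * (horner_alg t g0 * gi)).
    by rewrite g0i mulr1.
  transitivity (x%:A * gi * (horner_alg t g0 * horner_alg t p)); first ring.
  by rewrite eq; ring.
have yx (p : {poly A}) : (size p <= k.+1)%N -> exists2 q : {poly A}, (size q <= k.+2)%N &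
    y%:A * horner_alg t p = x%:A * horner_alg t q.
  move=> sp; have [|q sq eq] := H0 (g1 * p).
    apply: leq_trans (size_polyMleq _ _) _.
    have : (size g1 + size p <= d.+2 + k.+1)%N by exact: leq_add.
    by move: (size g1 + size p)%N; rewrite kd /n; lia.
  exists q; first by rewrite kd.
  rewrite -ey; move: eq; rewrite rmorphM /= => eq.
  transitivity (x%:A * gi * (horner_alg t g1 * horner_alg t p)); first ring.
  rewrite eq; transitivity (x%:A * horner_alg t q * (horner_alg t g0 * gi)).
    ring.
  by rewrite g0i mulr1.
have xkK : injective ( *%R (x%:A ^+ k : Q)).
  by apply: unit_inj; exists (x' ^+ k); rewrite -exprMn xx' expr1n.
(* [N] is [x^k W_k]; the factor [x^k] clears the denominators. *)
exists y, [set a : A | exists2 p : {poly A}, (size p <= k.+1)%N &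
  a%:A = x%:A ^+ k * horner_alg t p]; split=> //.
- split.
  + by exists 0; rewrite ?size_poly0// rmorph0 alg0 mulr0.
  + move=> a b [p sp ea] [q sq eb]; exists (p + q).
      by apply: leq_trans (size_polyD _ _) _; rewrite geq_max sp.
    by rewrite algD ea eb rmorphD mulrDr.
  + move=> b a [p sp ea]; exists (b *: p); first exact: leq_trans (size_scale_leq _ _) sp.
    by rewrite algM ea evZ; ring.
- exists (x ^+ k); last exact: lregX.
  by exists 1; rewrite ?size_poly1// rmorph1 mulr1 algX.
- move=> u a uxz [p sp ea].
  have [q sq eq] : exists2 q : {poly A}, (size q <= k.+1)%N &
      u%:A * horner_alg t p = y%:A * horner_alg t q.
    case: uxz => ->; first by apply: xy; exact: leqW.
    have [|q sq eq] := xy ('X * p).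
      by apply: leq_trans (size_polyMleq _ _) _; rewrite size_polyX.
    by exists q => //; rewrite -eq rmorphM /= horner_algX mulrA xt.
  have [b eb] := xnA q k sq; exists b; first by exists q.
  apply: (fraction_inj frac); rewrite /= !algM ea -eb.
  by rewrite mulrCA eq mulrCA.
- move=> a [p sp ea]; have [q sq eq] := yx p sp.
  have st : (size (take_poly 1 q) <= k.+1)%N.
    by apply: leq_trans (size_take_poly _ _) _.
  have sd : (size (drop_poly 1 q) <= k.+1)%N.
    by rewrite size_drop_poly leq_subLR add1n.
  have [b eb] := xnA _ _ st; have [b' eb'] := xnA _ _ sd.
  exists b, b'; split; [by exists (take_poly 1 q)|by exists (drop_poly 1 q)|].
  apply: (fraction_inj frac); rewrite /= algD !algM ea -eb -eb' mulrCA eq.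
  rewrite -{1}(poly_take_drop 1 q) rmorphD rmorphM /= horner_algX -xt; ring.
Qed.

Lemma ideal_gen_seq (s : seq A) a : ideal_gen [set` s] a ->
  exists r : nat -> A, a = \sum_(j < size s) r j * s`_j.
Proof.
move: a; apply: ideal_gen_min.
  split.
  - by exists (fun=> 0); rewrite big1// => j _; rewrite mul0r.
  - move=> a b [r ->] [r' ->]; exists (fun j => r j + r' j).
    by rewrite -big_split; apply: eq_bigr => j _; rewrite mulrDl.
  - move=> b a [r ->]; exists (fun j => b * r j).
    by rewrite mulr_sumr; apply: eq_bigr => j _; rewrite mulrA.
move=> a /= /(nthP 0)[i im <-]; exists (fun j => (j == i)%:R).
rewrite (bigD1 (Ordinal im)) //= eqxx mul1r big1 ?addr0// => j ji.
rewrite (_ : (j == i :> nat) = false) ?mul0r//.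
by apply: contraNF ji => /eqP ji; apply/eqP/val_inj.
Qed.

Lemma ideal_powD (I : set A) i j a b :
  ideal_pow I i a -> ideal_pow I j b -> ideal_pow I (i + j) (a * b).
Proof.
elim: i a => [|i IH] a /=.
  by move=> _ Ib; exact: (idealMl _ (ideal_pow_ideal I j)) Ib.
move=> Ia Ib; move: a Ia; apply: ideal_mul_min.
  have Kid := ideal_pow_ideal I (i.+1 + j)%N; split.
  - by rewrite /= mul0r; exact: (ideal0 Kid).
  - by move=> a c Ka Kc; rewrite /= mulrDl; exact: (idealD Kid Ka Kc).
  - by move=> a c Kc; rewrite /= -mulrA; exact: (idealMl _ Kid Kc).
by move=> a c Ia Ic; rewrite /= -mulrA; apply: ideal_mulP => //; exact: IH.
Qed.

(* Determinant trick, in the form of Nakayama's lemma for the values at [1/y] of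
   the Rees polynomials, whose [i]-th coefficient lies in [I^i]. *)
Lemma integral_closure_mem (I N : set A) x y z : is_ideal I -> I x -> I z ->
  GRing.lreg y -> is_ideal N -> (exists2 r, N r & GRing.lreg r) ->
  (forall a, N a -> exists b c, [/\ N b, N c & y * a = x * b + z * c]) ->
  ideal_integral_closure I y.
Proof.
move=> Iid Ix Iz yreg Nid [r Nr rreg] yN.
have [s Ns] := noeth Nid; have [yi yyi] := fraction_inv frac yreg.
pose rees (p : {poly A}) := p`_0 = 0 /\ forall i, ideal_pow I i p`_i.
pose aa : set Q := [set horner_alg yi p | p in rees].
have Iid' i := ideal_pow_ideal I i.
have [||||||i im|a [p [p0 pI] <-] aS] :=
    @nakayama Q aa [set 0] _ _ _ _ _ _ (size s) (fun j => (s`_j)%:A).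
- by exists 0; rewrite ?rmorph0//; split=> [|i]; rewrite coef0//; exact: ideal0.
- move=> _ _ [p [p0 pI] <-] [q [q0 qI] <-]; exists (p - q); last by rewrite rmorphB.
  by split=> [|i]; rewrite coefB ?p0 ?q0 ?subr0//; exact: idealB.
- move=> _ _ [p [p0 pI] <-] [q [q0 qI] <-]; exists (p * q); last by rewrite rmorphM.
  split; first by rewrite coef0M p0 mul0r.
  move=> i; rewrite coefM; apply: ideal_sum => // -[j /= ji] _.
  have := ideal_powD (pI j) (qI (i - j)%N).
  by rewrite subnKC// -ltnS.
- by [].
- by move=> v w -> ->; rewrite subr0.
- by move=> u v _ ->; rewrite mulr0.
- have Nsi : N s`_i by rewrite Ns; apply: ideal_genS; exact: mem_nth.
  have [b [c [Nb Nc e]]] := yN _ Nsi.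
  move: Nb Nc; rewrite Ns => /ideal_gen_seq[v ev] /ideal_gen_seq[w ew].
  exists (fun j => horner_alg yi ((x * v j + z * w j) *: 'X)).
    move=> j; exists ((x * v j + z * w j) *: 'X) => //; split.
      by rewrite coefZ coefX mulr0.
    move=> [|[|l]]; rewrite coefZ coefX ?mulr0; [by []| |exact: ideal0].
    rewrite mulr1 ideal_pow1//; apply: idealD => //; exact: idealMr.
  apply/eqP; rewrite subr_eq0; apply/eqP.
  apply: (unit_inj (ex_intro _ yi yyi)); rewrite /= -algM e ev ew.
  rewrite !mulr_sumr -big_split /= alg_sum; apply: eq_bigr => j _.
  rewrite evZ horner_algX.
  transitivity ((x * v j + z * w j)%:A * (s`_j)%:A * (y%:A * yi)); last ring.
  by rewrite yyi mulr1 -algM; congr (_%:A); ring.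
(* [1 - p(1/y)] kills [N], which contains a regular element; so [p(1/y) = 1], and a power of [y]
   clears denominators. *)
have er : r%:A * (1 - horner_alg yi p) = 0.
  move: Nr; rewrite Ns => /ideal_gen_seq[v ->].
  rewrite alg_sum mulr_suml big1// => j _.
  by rewrite algM -mulrA [_%:A * (1 - _)]mulrC aS ?mulr0.
have := unit_cancel (fraction_inv frac rreg) er.
move/eqP; rewrite subr_eq0 => /eqP e1.
have sp : (size p <= (size p).+1)%N by exact: leqnSn.
exists (size p), (fun i => - p`_i); split=> [i _|]; first exact: idealN.
apply: (fraction_inj frac); rewrite /= alg0 algD alg_sum.
move: e1; rewrite (ev_sum yi sp) -(big_mkord xpredT (fun i => (p`_i)%:A * yi ^+ i)).
rewrite big_ltn// p0 alg0 mul0r add0r => e1.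
have -> : (y ^+ size p)%:A = y%:A ^+ size p * 1 :> Q by rewrite mulr1 algX.
rewrite [X in _ * X]e1 mulr_sumr -big_split big_nat big1//=.
move=> i /andP[_]; rewrite ltnS => ip; rewrite algM algN algX.
rewrite -{1}(subnK ip) exprD.
have : y%:A ^+ i * yi ^+ i = 1 by rewrite -exprMn yyi expr1n.
move: (y%:A ^+ i) (yi ^+ i) => u v uv.
by transitivity ((p`_i)%:A * y%:A ^+ (size p - i) * (u * v - 1));
  [ring|rewrite uv subrr mulr0].
Qed.

(** From [I^n N] inside [y^n N], the sets [r I^n / y^n] are ideals of [A]. They increase with [n],
    and where they stabilize [I^(n+1) = y I^n]. *)
Lemma principal_reduction_of_module (I N : set A) y : is_ideal I -> I y ->
  GRing.lreg y -> (exists2 r, N r & GRing.lreg r) -> is_ideal N ->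
  (forall u a, I u -> N a -> exists2 b, N b & u * a = y * b) ->
  has_principal_reduction I.
Proof.
move=> Iid Iy yreg [r Nr rreg] Nid IN.
have powN n u a : ideal_pow I n u -> N a -> exists2 b, N b & u * a = y ^+ n * b.
  elim: n u a => [|n IH] u a.
    by move=> _ Na; exists (u * a); [exact: idealMl|rewrite mul1r].
  move=> + Na; move: u; apply: ideal_mul_min.
    split.
    - by exists 0; [exact: ideal0|rewrite mul0r mulr0].
    - move=> u v [b Nb eb] [b' Nb' eb']; exists (b + b'); first exact: idealD.
      by rewrite mulrDl eb eb' mulrDr.
    - move=> c u [b Nb eb]; exists (c * b); first exact: idealMl.
      by rewrite -mulrA eb mulrCA.
  move=> u v Iu Iv; have [b Nb eb] := IH v a Iv Na; have [b' Nb' eb'] := IN u b Iu Nb.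
  by exists b' => //; rewrite -mulrA eb mulrCA eb' exprSr mulrA.
pose G n := [set a | exists2 b, ideal_pow I n b & a * y ^+ n = r * b].
have [||_ [[n ->] Gmax]] := noetherian_max (F := fun J => exists n, J = G n) noeth.
- move=> _ [n ->]; have Kid := ideal_pow_ideal I n; split.
  + by exists 0; [exact: ideal0|rewrite mul0r mulr0].
  + move=> a b [u Iu ea] [v Iv eb]; exists (u + v); first exact: idealD.
    by rewrite mulrDl ea eb mulrDr.
  + move=> a b [u Iu eb]; exists (a * u); first exact: idealMl.
    by rewrite -mulrA eb mulrCA.
- by exists (G 0%N), 0%N.
exists y, n; split=> //; apply/seteqP; split=> [b Ib|_ [b Ib <-]]; last exact: ideal_mulP.
have [a _ ea] := powN _ _ _ Ib Nr.
have [|||b' Ib' eb'] := Gmax (G n.+1) _ _ a; first by exists n.+1.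
- move=> c [u Iu ec]; exists (y * u); first exact: ideal_mulP.
  by rewrite exprSr mulrA ec; ring.
- by exists b; rewrite // mulrC -ea mulrC.
exists b' => //; apply: rreg.
by rewrite [RHS]mulrC ea exprS mulrCA -eb'; ring.
Qed.

Hypothesis semiloc : semi_local A.
Hypothesis dim1 : forall (P : set A) x,
  GRing.lreg x -> prime_ideal P -> P x -> maximal_ideal P.
Hypothesis strict : forall b : integral_closure Q, strict_closure b ->
  exists a, ic_val b = a%:A.

(** Generators of [I] are absorbed one at a time: [y] and a new generator [u] are replaced by [y'],
    and [N] by [N N']. The element [y'] stays in [I] because it is integral over [I]. *)
Lemma principal_reduction (I : set A) : integrally_closed_ideal I ->
  (exists2 x, I x & GRing.lreg x) -> has_principal_reduction I.
Proof.
move=> [Iid Icl] [x Ix xreg].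
have [us Ius] := noeth Iid.
have usI u : u \in us -> I u by rewrite Ius => ?; exact: ideal_genS.
have [y [N [Iy yreg Nid Nreg yN]]] : exists y (N : set A), [/\ I y, GRing.lreg y,
    is_ideal N, exists2 r, N r & GRing.lreg r &
    forall u a, u \in us -> N a -> exists2 b, N b & u * a = y * b].
  elim: us usI {Ius} => [|u us IH] usI.
    by exists x, setT; split=> //; exists x.
  have [|y [N [Iy yreg Nid [r Nr rreg] yN]]] := IH.
    by move=> v vus; apply: usI; rewrite inE vus orbT.
  have [e eP] := semi_local_complement y semiloc.
  have Iu : I u by apply: usI; rewrite inE eqxx.
  have [y' [N' [y'reg N'id [r' N'r' r'reg] uN' y'N']]] :=
    two_generator_reduction u yreg (fun P => @dim1 P y yreg) eP strict.
  exists y', (ideal_mul N N'); split=> //.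
  - rewrite -Icl; apply: (integral_closure_mem Iid Iy Iu y'reg N'id _ y'N').
    by exists r'.
  - exact: ideal_mul_ideal.
  - by exists (r * r'); [exact: ideal_mulP|exact: lregM].
  - move=> v a; rewrite inE => vus; have Kid := ideal_mul_ideal N N'.
    move: a; apply: ideal_mul_min.
      split.
      + by exists 0; [exact: (ideal0 Kid)|rewrite !mulr0].
      + move=> a b [a' Ka' ea] [b' Kb' eb]; exists (a' + b').
          exact: (idealD Kid Ka' Kb').
        by rewrite mulrDr ea eb mulrDr.
      + move=> c a [a' Ka' ea]; exists (c * a').
          exact: (idealMl _ Kid Ka').
        by rewrite mulrCA ea mulrCA.
    move=> a b Na N'b; case/orP: vus => [/eqP->|vus].
      have [|b' N'b' e'] := uN' u b _ N'b; first by right.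
      exists (a * b'); first exact: ideal_mulP.
      by rewrite mulrCA e' mulrCA.
    have [a' Na' ea] := yN v a vus Na.
    have [|b' N'b' eb] := uN' y b _ N'b; first by left.
    exists (a' * b'); first exact: ideal_mulP.
    by rewrite mulrA ea mulrAC eb; ring.
apply: (principal_reduction_of_module Iid Iy yreg Nreg Nid).
move=> u a + Na; rewrite Ius; move: u; apply: ideal_gen_min; last first.
  by move=> u uus; exact: yN.
split.
- by exists 0; [exact: ideal0|rewrite mul0r mulr0].
- move=> u v [b Nb eb] [b' Nb' eb']; exists (b + b'); first exact: idealD.
  by rewrite mulrDl eb eb' mulrDr.
- move=> c u [b Nb eb]; exists (c * b); first exact: idealMl.
  by rewrite -mulrA eb mulrCA.
Qed.

End Reductions.

Lemma strictly_closed_arf (A : comNzRingType) : semi_local_one_dim_cm A ->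
  strictly_closed_in (integral_closure (total_frac A)) -> arf_ring A.
Proof.
move=> hA closed; have [noeth semiloc _] := hA.
have frac := total_frac_fraction_ring A.
have strict (b : integral_closure (total_frac A)) : strict_closure b ->
    exists a, ic_val b = a%:A.
  by rewrite closed => -[a _ <-]; exists a.
split=> // [I Icl Ireg|x y z xreg iy iz].
  apply: (principal_reduction noeth frac semiloc _ strict Icl Ireg) => P x xreg Ppr Px.
  exact: prime_regular_maximal hA xreg Ppr Px.
pose u : integral_closure (total_frac A) := IntegralClosure (asboolT iy).
pose v : integral_closure (total_frac A) := IntegralClosure (asboolT iz).
have valZ a (w : integral_closure (total_frac A)) :
    ic_val (a *: w) = a%:A * ic_val w by rewrite mulr_algl.
have eu : x *: u = y%:A.
  by apply: val_inj; apply: etrans (valZ _ _) _; exact: tfracE.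
have ev : x *: v = z%:A.
  by apply: val_inj; apply: etrans (valZ _ _) _; exact: tfracE.
have [a ea] := strict _ (strict_closure_div eu ev).
exists a; rewrite -ea; apply/esym/tfrac_unique; rewrite valZ.
transitivity ((x%:A * tfrac y xreg) * (x%:A * tfrac z xreg)).
  by rewrite [RHS]mulrACA -[RHS]mulrA.
by rewrite !tfracE algM.
Qed.

Theorem theorem4p4 (A : comNzRingType) (hA : semi_local_one_dim_cm A) :
  strictly_closed_in (integral_closure (total_frac A)) <-> arf_ring A.
Proof. by split; [exact: strictly_closed_arf|exact: arf_strictly_closed]. Qed.
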